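(* Let $\pi$ be a tree sequence and let $G\in\mathcal{T}_\pi$. Then $G$ is extremal in $\mathcal{T}_\pi$ (i.e. $\lambda(G)=\max\{\lambda(T):T\in\mathcal{T}_\pi\}$) if and only if $G$ is a BFD-tree. Such an extremal tree is uniquely determined up to isomorphism. Moreover, if $G$ is extremal and $f$ is an eigenvector of $L(G)$ for $\lambda(G)$, then $G$ has a BFD-ordering $\prec$ that is consistent with $f$ in the sense that $|f(u)|>|f(v)|$ implies $u\prec v$.
   Context: For a graph $G=(V,E)$ the Laplacian is $L(G)=D(G)-A(G)$, where $A(G)$ is the adjacency matrix and $D(G)$ the diagonal matrix of vertex degrees $d(v)$. $\lambda(G)$ denotes the largest eigenvalue of $L(G)$. A sequence $\pi=(d_0,\ldots,d_{n-1})$ (written non-increasingly) is a tree sequence if it is the degree sequence of some tree; $\mathcal{T}_\pi$ is the set of all trees with degree sequence $\pi$. A tree in $\mathcal{T}_\pi$ is called extremal if it has the largest value of $\lambda$ among all trees in $\mathcal{T}_\pi$. For a connected graph with a chosen root $v_0$, a child of a vertex $w$ is a neighbor $v$ of $w$ with $\mathrm{dist}(v_0,v)=\mathrm{dist}(v_0,w)+1$ ($w$ is then the parent of $v$). A BFD-ordering (breadth-first search ordering with decreasing degrees) with root $v_0$ is a total ordering $\prec$ of the vertices arising from a breadth-first search starting at $v_0$ (so $v_0$ is first and vertices closer to $v_0$ precede vertices farther from $v_0$) such that: (B1) if $w_1\prec w_2$ then $v_1\prec v_2$ for every child $v_1$ of $w_1$ and every child $v_2$ of $w_2$; (B2) if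 $v\prec u$ then $d(v)\ge d(u)$. A BFD-tree (BFD-graph) is a tree (connected graph) admitting a BFD-ordering for some root. *)

(* Defs.v *)
(* Simple graphs on the vertex set 'I_n, as symmetric
   irreflexive boolean relations; real numbers = an arbitrary real closed field. *)
From HB Require Import structures.
From mathcomp Require Import all_boot all_order all_fingroup all_algebra.
Set Implicit Arguments. Unset Strict Implicit. Unset Printing Implicit Defensive.
Import Order.TTheory GRing.Theory Num.Theory.

Section Graphs.
Variable n : nat.
Implicit Types (g : rel 'I_n).

Definition deg g (v : 'I_n) : nat := #|[pred u | g v u]|.

Definition simple_graph g : Prop := symmetric g /\ irreflexive g.

Definition connected g : Prop := forall x y : 'I_n, connect g x y.

Definition acyclic g : Prop :=
  forall (x : 'I_n) (s : seq 'I_n),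
    uniq (x :: s) -> 2 <= size s -> path g x s -> ~~ g (last x s) x.

Definition is_tree g : Prop := 0 < n /\ simple_graph g /\ connected g /\ acyclic g.

Definition has_degseq g (pi : seq nat) : Prop :=
  perm_eq [seq deg g v | v <- enum 'I_n] pi.

Fixpoint ball g (x : 'I_n) (k : nat) : {set 'I_n} :=
  match k with
  | 0 => [set x]
  | k'.+1 => ball g x k' :|: [set y | [exists z in ball g x k', g z y]]
  end.

(* graph distance (for connected graphs; all distances are < n) *)
Definition dist g (x y : 'I_n) : nat := find (fun k => y \in ball g x k) (iota 0 n).

Definition child g (v0 w v : 'I_n) : bool :=
  g w v && (dist g v0 v == (dist g v0 w).+1).

(* a total ordering of the vertices, given as an enumeration s *)
Definition prec (s : seq 'I_n) (u v : 'I_n) : bool := index u s < index v s.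

Definition BFD_ordering g (v0 : 'I_n) (s : seq 'I_n) : Prop :=
  [/\ perm_eq s (enum 'I_n),
      head v0 s = v0,
      (forall u v, dist g v0 v < dist g v0 u -> prec s v u),
      (forall w1 w2 v1 v2, child g v0 w1 v1 -> child g v0 w2 v2 ->
           prec s w1 w2 -> prec s v1 v2) &
      (forall u v, prec s v u -> deg g u <= deg g v)].

Definition BFD_tree g : Prop :=
  is_tree g /\ exists v0 s, BFD_ordering g v0 s.

Definition isomorphic g h : Prop :=
  exists sigma : {perm 'I_n}, forall u v, g u v = h (sigma u) (sigma v).

Variable R : rcfType.
Local Open Scope ring_scope.

Definition adjm g : 'M[R]_n := \matrix_(i, j) (g i j)%:R.
Definition degm g : 'M[R]_n := \matrix_(i, j) ((deg g i)%:R *+ (i == j)).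
Definition laplacian g : 'M[R]_n := degm g - adjm g.

Definition largest_eig (A : 'M[R]_n) (l : R) : Prop :=
  eigenvalue A l /\ forall m, eigenvalue A m -> m <= l.

Definition eigenvector (A : 'M[R]_n) (l : R) (f : 'rV[R]_n) : Prop :=
  f != 0 /\ f *m A = l *: f.

End Graphs.

Local Open Scope ring_scope.

Definition tree_seq (pi : seq nat) : Prop :=
  sorted geq pi /\
  exists g : rel 'I_(size pi), is_tree g /\ has_degseq g pi.

Definition in_Tpi (pi : seq nat) (g : rel 'I_(size pi)) : Prop :=
  is_tree g /\ has_degseq g pi.
Arguments in_Tpi : clear implicits.

Definition extremal (R : rcfType) (pi : seq nat) (g : rel 'I_(size pi)) : Prop :=
  exists l : R, largest_eig (laplacian R g) l /\
    forall (t : rel 'I_(size pi)) (l' : R),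
      in_Tpi pi t -> largest_eig (laplacian R t) l' -> l' <= l.
Arguments extremal : clear implicits.

(* Main.v *)
Require Import Defs.
From HB Require Import structures.
From mathcomp Require Import all_boot all_order all_fingroup all_algebra.
From mathcomp Require Import complex ring lra zify.
Set Implicit Arguments. Unset Strict Implicit. Unset Printing Implicit Defensive.
Import Order.TTheory GRing.Theory Num.Theory.

(** A tree is bipartite, so its Laplacian is similar to the signless Laplacian
    Q = D + A by a diagonal sign matrix: the largest eigenvalue l is a Perron root,
    and |f| is a positive eigenvector of Q.  For a positive eigenvector f, the
    ground state representation shows that <x, Q x> <= l <x, x>, with equality only
    if x is proportional to f.

    Hence, if G is extremal with positive eigenvector f, and a tree G' with the same
    degrees satisfies <f, Q' f> >= <f, Q f>, then Q' f = Q f.  Moving edges from u to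
    v gives: d(u) > d(v) implies f(u) > f(v).  Replacing the two end edges ab, cd of
    a path a b ... c d by ac, bd changes the form by 2 (f(a) - f(d)) (f(c) - f(b)), so
    f(a) - f(d) and f(b) - f(c) have the same sign.  Rooting G at a maximum of f,
    these signs propagate along paths, so f decreases along a breadth-first
    ordering in which siblings are sorted by f.

    Conversely, a BFD-ordering determines the tree: the positions of the parents form
    a sorted sequence whose multiplicities are prescribed by the degrees.  Since an
    extremal tree exists, every BFD-tree is isomorphic to it. *)

(** * Perron vectors of the signless Laplacian *)

Section NonnegSymmetric.
Local Open Scope ring_scope.
Variable R : rcfType.
Local Notation C := (R[i]).

(** Among unit vectors the Hermitian form is maximal exactly on the top eigenspace. Taking absolute
    values of the entries of a top eigenvector keeps its norm and, as [A] is nonnegative, does not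
    lower the form, so the result is again a top eigenvector. *)
Lemma nonneg_symmetric_eigenvector n (A : 'M[C]_n) :
  (0 < n)%N -> A^T = A -> (forall i j, 0 <= A i j) ->
  exists (l : R) (y : 'rV[R]_n),
    [/\ y != 0, forall i, 0 <= y 0 i &
        map_mx (real_complex R) y *m A = (real_complex R l) *: map_mx (real_complex R) y].
Proof.
move=> n_gt0 Asym A_ge0.
have Areal : A \is a mxOver Num.real.
  by apply/mxOverP => i j; rewrite ger0_real.
have Aherm : A \is hermsymmx.
  apply: realsym_hermsym => //; apply/is_hermitianmxP.
  by rewrite expr0 scale1r map_mx_id.
have AE := orthomx_spectralP (hermitian_normalmx Aherm).
have Dreal := hermitian_spectral_diag_real Aherm.
have Pu := spectral_unitarymx A.
move: AE Dreal Pu; set P := spectralmx A; set D := spectral_diag A => AE Dreal Pu.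
have PV := invmx_unitary Pu.
(* The spectrum is real, so it can be maximised through real parts. *)
have [i0 maxi0] : exists i0, forall i, D 0 i <= D 0 i0.
  pose d i := complex.Re (D 0 i).
  have dE i : D 0 i = (d i)%:C%C by rewrite RRe_real //; apply: (mxOverP Dreal).
  exists [arg max_(i > Ordinal n_gt0) d i]%O => i.
  case: arg_maxP => // j _ /(_ i isT); rewrite !dE lecR; exact.
set lam := D 0 i0 in maxi0.
have lamR : lam = (complex.Re lam)%:C%C by rewrite RRe_real //; apply: (mxOverP Dreal).
pose nrm (x : 'rV[C]_n) := \sum_i `|x 0 i| ^+ 2.
have dotE (x : 'rV[C]_n) : (x *m (map_mx Num.conj x)^T) 0 0 = nrm x.
  by rewrite mxE; apply: eq_bigr => i _; rewrite !mxE normCK.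
pose w (x : 'rV[C]_n) := x *m invmx P.
have formE (x : 'rV[C]_n) : (x *m A *m (map_mx Num.conj x)^T) 0 0 =
    \sum_i D 0 i * `|w x 0 i| ^+ 2.
  have -> : x *m A *m (map_mx Num.conj x)^T =
     w x *m diag_mx D *m (map_mx Num.conj (w x))^T.
    rewrite /w AE map_mxM trmx_mul /= PV -!mulmxA; congr (_ *m (_ *m (_ *m _))).
    by rewrite map_mxCK trmxK.
  rewrite mxE; apply: eq_bigr => i _; rewrite mul_mx_diag !mxE normCK.
  by rewrite mulrAC mulrC.
have nrmw (x : 'rV[C]_n) : nrm (w x) = nrm x.
  rewrite -!dotE /w map_mxM trmx_mul mulmxA PV map_mxCK trmxK.
  by rewrite -[x *m _ *m _]mulmxA (mulmx1C (unitarymxP Pu)) mulmx1.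
pose z := row i0 P.
have wz : w z = delta_mx 0 i0.
  by rewrite /w /z -row_mul mulmxV ?unitarymx_unit // row1.
pose y : 'rV[C]_n := map_mx Num.norm z.
have nrmy : nrm y = nrm z.
  by apply: eq_bigr => i _; rewrite mxE normr_id.
have nrmz : nrm z = 1.
  rewrite -nrmw wz /nrm (bigD1 i0) //= big1 => [|i ni].
    by rewrite mxE !eqxx normr1 expr1n addr0.
  by rewrite mxE eqxx (negbTE ni) normr0 expr0n.
have formz : (z *m A *m (map_mx Num.conj z)^T) 0 0 = lam.
  rewrite formE wz (bigD1 i0) //= big1 => [|i ni].
    by rewrite mxE !eqxx normr1 expr1n addr0 mulr1.
  by rewrite mxE eqxx (negbTE ni) normr0 expr0n mulr0.
have formy : lam <= (y *m A *m (map_mx Num.conj y)^T) 0 0.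
  apply: le_trans (_ : `|lam| <= _).
    by apply: real_ler_norm; apply: (mxOverP Dreal).
  rewrite -formz mxE [X in _ <= X]mxE.
  apply: le_trans (ler_norm_sum _ _ _) _; apply: ler_sum => i _.
  rewrite normrM ![in X in _ <= X]mxE conj_normC !mxE norm_conjC.
  rewrite ler_wpM2r //; apply: le_trans (ler_norm_sum _ _ _) _.
  by apply: ler_sum => j _; rewrite normrM !mxE (ger0_norm (A_ge0 _ _)).
(* In spectral coordinates the defect is a sum of nonnegative terms; once it vanishes, [y] has
   components only where [D] equals [lam]. *)
have eq0 : \sum_i (lam - D 0 i) * `|w y 0 i| ^+ 2 = 0.
  apply/eqP; rewrite eq_le; apply/andP; split; last first.
    by apply: sumr_ge0 => i _; rewrite mulr_ge0 ?subr_ge0 ?exprn_ge0.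
  under eq_bigr do rewrite mulrBl.
  rewrite big_split /= sumrN -formE -mulr_sumr subr_le0.
  by rewrite -/(nrm _) nrmw nrmy nrmz mulr1.
have wD : w y *m diag_mx D = lam *: w y.
  apply/rowP => i; rewrite mul_mx_diag mxE [RHS]mxE.
  have /eqP := eq0; rewrite psumr_eq0; last first.
    by move=> j _; rewrite mulr_ge0 ?subr_ge0 ?exprn_ge0.
  move=> /allP/(_ i (mem_index_enum _)) /=; rewrite mulf_eq0 expf_eq0 /= normr_eq0 subr_eq0.
  by case/orP => /eqP ->; rewrite ?mulr0 ?mul0r // mulrC.
have yA : y *m A = lam *: y.
  rewrite {1}AE !mulmxA -/(w y) wD -scalemxAl /w.
  by rewrite -mulmxA mulVmx ?unitarymx_unit // mulmx1.
have yR : y = map_mx (real_complex R) (map_mx (@complex.Re R) y).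
  apply/rowP => i; rewrite [RHS]mxE [in RHS]mxE RRe_real //.
  by rewrite mxE ger0_real.
exists (complex.Re lam), (map_mx (@complex.Re R) y); split.
- apply/eqP => y0; move: nrmz; rewrite -nrmy yR y0 /nrm big1 => [|i _].
    by move/esym/eqP; rewrite oner_eq0.
  by rewrite !mxE normr0 expr0n.
- move=> i; rewrite mxE; have : 0 <= y 0 i by rewrite mxE.
  by rewrite lecE => /andP[].
- by rewrite -yR yA {1}lamR.
Qed.
End NonnegSymmetric.

Section Signless.
Local Open Scope ring_scope.
Variables (n : nat) (R : rcfType).
Implicit Types (g : rel 'I_n) (f x : 'I_n -> R).

Definition nbsum g f v : R := \sum_u (g v u)%:R * f u.
Definition signless g f v : R := (deg g v)%:R * f v + nbsum g f v.
Definition qform g f : R := \sum_v f v * signless g f v.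
Definition sqnorm f : R := \sum_v f v ^+ 2.
Definition perron g (l : R) f : Prop :=
  (forall v, 0 < f v) /\ (forall v, signless g f v = l * f v).

Definition degrees g := [seq deg g v | v <- enum 'I_n].

(** Extremality phrased through Perron pairs, so that the exchange arguments need only the signless
    form; [perron_largest_eig] links it to the Laplacian. *)
Definition perron_maximal g (l : R) : Prop :=
  forall (h : rel 'I_n) (l' : R) f', is_tree h ->
    perm_eq (degrees h) (degrees g) -> perron h l' f' -> l' <= l.

Lemma connected_ind g (P : 'I_n -> Prop) v0 : connected g ->
  P v0 -> (forall u v, P u -> g u v -> P v) -> forall v, P v.
Proof.
move=> gC P0 Pg v; have /connectP[p] := gC v0 v.
elim: p v0 P0 => /= [|u p IH] v0 P0; first by move=> _ ->.
by case/andP=> /(Pg _ _ P0) Pu; exact: IH.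
Qed.

(** If a nonnegative eigenvector vanishes at a vertex, its eigenvalue equation there forces it to
    vanish at all neighbours, hence everywhere by connectedness. *)
Lemma perron_exists g : (0 < n)%N -> simple_graph g -> connected g ->
  exists l f, perron g l f.
Proof.
move=> n_gt0 [gS gI] gC.
pose A : 'M[R[i]]_n := \matrix_(i, j) ((deg g i)%:R *+ (i == j) + (g i j)%:R).
have AS : A^T = A.
  apply/matrixP => i j; rewrite !mxE gS; congr (_ + _).
  by case: (eqVneq j i) => [->|].
have A_ge0 i j : 0 <= A i j by rewrite mxE addr_ge0 ?mulrn_wge0 ?ler0n.
have [l [y [y_neq0 y_ge0 yA]]] := nonneg_symmetric_eigenvector n_gt0 AS A_ge0.
have eqy v : signless g (fun u => y 0 u) v = l * y 0 v.
  apply: (@complexI R); move/rowP/(_ v): yA; rewrite mxE [RHS]mxE [in RHS]mxE.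
  rewrite -rmorphM => <-; rewrite rmorphD /= rmorphM /= rmorph_sum /=.
  under [RHS]eq_bigr => i _ do rewrite !mxE mulrDr.
  rewrite big_split /=; congr (_ + _); last first.
    by apply: eq_bigr => u _; rewrite rmorphM /= rmorph_nat mulrC gS.
  rewrite (bigD1 v) //= eqxx mulr1n big1 => [|u nu]; last first.
    by rewrite (negbTE nu) mulr0n mulr0.
  by rewrite addr0 rmorph_nat mulrC.
exists l, (fun u => y 0 u); split=> // v; rewrite lt0r y_ge0 andbT.
apply: contra_neq y_neq0 => yv0; apply/rowP => i; rewrite mxE.
move: i; apply: (connected_ind gC yv0) => u w yu0 guw.
have := eqy u; rewrite /signless yu0 !mulr0 add0r => /eqP.
rewrite psumr_eq0 => [/allP/(_ w (mem_index_enum _))|i _] /=.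
  by rewrite guw mul1r => /eqP.
by rewrite mulr_ge0 ?ler0n.
Qed.

(* Ground state representation: substituting [x = f y] turns the defect of the
   Rayleigh quotient into a sum of squares over the edges. *)
Lemma perron_defect g l f x : symmetric g -> perron g l f ->
  2 * (l * sqnorm x - qform g x) =
  \sum_u \sum_v (g u v)%:R * f u * f v * (x u / f u - x v / f v) ^+ 2.
Proof.
move=> gS [f_gt0 fE]; pose y u := x u / f u.
have xE u : x u = f u * y u.
  by rewrite /y mulrC divfK // gt_eqF.
pose S1 := \sum_u \sum_v (g u v)%:R * f u * f v * (y u ^+ 2 - y u * y v).
have S1E : l * sqnorm x - qform g x = S1.
  rewrite /sqnorm /qform mulr_sumr -sumrB; apply: eq_bigr => u _.
  have -> : l * x u ^+ 2 = (signless g f u) * f u * y u ^+ 2.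
    by rewrite fE xE; ring.
  rewrite /signless mulrDl mulrDl mulrDr.
  have -> : (deg g u)%:R * f u * f u * y u ^+ 2 = x u * ((deg g u)%:R * x u).
    by rewrite xE; ring.
  rewrite opprD addrACA subrr add0r /nbsum !mulr_suml mulr_sumr -sumrB.
  by apply: eq_bigr => v _; rewrite (xE u) (xE v); ring.
(* Exchanging the summation variables gives the mirrored form; the two add up to complete
   squares. *)
have S1E' : l * sqnorm x - qform g x =
    \sum_u \sum_v (g u v)%:R * f u * f v * (y v ^+ 2 - y u * y v).
  rewrite S1E /S1 exchange_big /=; apply: eq_bigr => u _; apply: eq_bigr => v _.
  by rewrite gS; ring.
rewrite mulrDl mul1r {1}S1E S1E' -big_split; apply: eq_bigr => u _ /=.
by rewrite -big_split; apply: eq_bigr => v _ /=; rewrite -!/(y _); ring.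
Qed.

Lemma perron_rayleigh g l f x : symmetric g -> perron g l f ->
  qform g x <= l * sqnorm x.
Proof.
move=> gS pf; rewrite -subr_ge0 -(pmulr_rge0 _ (ltr0Sn R 1)).
rewrite (perron_defect _ gS pf); case: pf => f_gt0 _.
have f_ge0 u : 0 <= f u by rewrite ltW.
apply: sumr_ge0 => u _; apply: sumr_ge0 => v _.
by apply: mulr_ge0; rewrite ?sqr_ge0 // !mulr_ge0 ?ler0n.
Qed.

(** Every square in [perron_defect] vanishes, so [x / f] is constant along edges. *)
Lemma perron_rayleigh_eq g l f x : (0 < n)%N -> symmetric g -> connected g ->
  perron g l f -> qform g x = l * sqnorm x -> exists c, forall v, x v = c * f v.
Proof.
move=> n_gt0 gS gC pf qx; have := perron_defect x gS pf.
rewrite qx subrr mulr0 => /esym/eqP; case: pf => f_gt0 _.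
have f_ge0 u : 0 <= f u by rewrite ltW.
rewrite psumr_eq0 => [/allP eq0|u _]; last first.
  apply: sumr_ge0 => v _.
  by apply: mulr_ge0; rewrite ?sqr_ge0 // !mulr_ge0 ?ler0n.
pose v0 := Ordinal n_gt0.
exists (x v0 / f v0) => v; have fn0 u : f u != 0 by rewrite gt_eqF.
suff <- : x v / f v = x v0 / f v0 by rewrite divfK.
move: v; apply: (connected_ind gC (v0 := v0)) => // u w <- guw.
have := eq0 u (mem_index_enum _); rewrite /= psumr_eq0 => [|v _]; last first.
  by apply: mulr_ge0; rewrite ?sqr_ge0 // !mulr_ge0 ?ler0n.
move=> /allP/(_ w (mem_index_enum _)) /=; rewrite guw !mulf_eq0 /=.
by rewrite oner_eq0 !(negbTE (fn0 _)) /= orbb subr_eq0 => /eqP ->.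
Qed.

Lemma sqnorm_gt0 f : (exists v, f v != 0) -> 0 < sqnorm f.
Proof.
case=> v fv; rewrite /sqnorm (bigD1 v) //= ltr_wpDr //.
  by apply: sumr_ge0 => u _; apply: sqr_ge0.
by rewrite lt0r sqr_ge0 sqrf_eq0 fv.
Qed.

Lemma qform_eigen g l f : (forall v, signless g f v = l * f v) ->
  qform g f = l * sqnorm f.
Proof.
by move=> fE; rewrite /qform /sqnorm mulr_sumr; apply: eq_bigr => v _; rewrite fE; ring.
Qed.

Lemma signlessZ g f h c : (forall v, h v = c * f v) ->
  forall v, signless g h v = c * signless g f v.
Proof.
move=> hE v; rewrite /signless hE mulrDr; congr (_ + _); first by ring.
by rewrite /nbsum mulr_sumr; apply: eq_bigr => u _; rewrite hE; ring.
Qed.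

Lemma perron_rayleigh_eigen g l f x : (0 < n)%N -> symmetric g -> connected g ->
  perron g l f -> qform g x = l * sqnorm x -> forall v, signless g x v = l * x v.
Proof.
move=> n_gt0 gS gC pf qx v; have [c cE] := perron_rayleigh_eq n_gt0 gS gC pf qx.
by rewrite (signlessZ g cE) cE pf.2; ring.
Qed.
End Signless.

(** * Rooted trees *)

Section RootedGraphs.
Variables (n : nat) (g : rel 'I_n).
Hypothesis gC : connected g.
Implicit Types (u v w x y : 'I_n).

Lemma path_ball x p : path g x p -> last x p \in ball g x (size p).
Proof.
elim/last_ind: p => [|p y IH] /=; first by rewrite inE.
rewrite rcons_path last_rcons size_rcons => /andP[/IH lp gy] /=.
by rewrite !inE; apply/orP; right; apply/existsP; exists (last x p); rewrite lp.
Qed.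

(** A path without repetition has fewer than [n] edges, so the search in [iota 0 n] never falls
    through to its default. *)
Lemma dist_ball x y : y \in ball g x (dist g x y).
Proof.
have hy : has (fun k => y \in ball g x k) (iota 0 n).
  have /connectP[p gp ->] := gC x y; case/shortenP: gp => q gq uq _.
  apply/hasP; exists (size q); last exact: path_ball.
  rewrite mem_iota /= add0n; have := card_uniqP uq => /= <-.
  by rewrite -[X in _ <= X]card_ord max_card.
have := nth_find 0 hy; rewrite nth_iota //.
by move: hy; rewrite has_find size_iota.
Qed.

Lemma dist_leq x y k : y \in ball g x k -> dist g x y <= k.
Proof.
move=> yk; rewrite leqNgt; apply/negP => lt_k.
have := before_find 0 lt_k; rewrite nth_iota ?add0n ?yk //.
by apply: leq_trans lt_k _; rewrite -{2}(size_iota 0 n) find_size.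
Qed.

Lemma distxx x : dist g x x = 0.
Proof. by apply/eqP; rewrite -leqn0 dist_leq //= inE. Qed.

Lemma dist_eq0 x y : (dist g x y == 0) = (y == x).
Proof.
apply/eqP/eqP => [d0|->]; last exact: distxx.
by have := dist_ball x y; rewrite d0 inE => /eqP.
Qed.

Lemma dist_edge x u v : g u v -> dist g x v <= (dist g x u).+1.
Proof.
move=> guv; apply: dist_leq => /=; rewrite !inE; apply/orP; right.
by apply/existsP; exists u; rewrite dist_ball.
Qed.

Lemma ex_parent x v : v != x -> exists w, child g x w v.
Proof.
rewrite -dist_eq0; case E: (dist g x v) => [//|k] _.
have := dist_ball x v; rewrite E /= !inE => /orP[/dist_leq|].
  by rewrite E ltnn.
case/existsP => w /andP[/dist_leq dw gwv]; exists w; rewrite /child gwv E.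
by have := dist_edge x gwv; rewrite E ltnS eqSS eqn_leq dw andbT.
Qed.

Lemma child_neq_root x w v : child g x w v -> v != x.
Proof. by case/andP => _ /eqP dv; rewrite -dist_eq0 dv. Qed.

Definition avoid (X : pred 'I_n) : rel 'I_n :=
  [rel x y | [&& g x y, ~~ X x & ~~ X y]].

(** Climbing from [y] through successive parents strictly lowers the distance to [x], so the walk
    never reaches the level of a vertex of [X]. *)
Lemma connect_avoid (X : pred 'I_n) x y : ~~ X x -> ~~ X y ->
  (forall z, X z -> dist g x y <= dist g x z) -> connect (avoid X) x y.
Proof.
move=> Xx; have [k] := ubnP (dist g x y); elim: k y => // k IH y.
rewrite ltnS => dy Xy dX; have [->//|yx] := eqVneq y x.
have [w /andP[gwy /eqP dw]] := ex_parent yx.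
have Xw : ~~ X w by apply/negP => /dX; rewrite dw ltnn.
apply: connect_trans (_ : connect _ w y); last first.
  by apply: connect1; rewrite /avoid /= gwy Xw Xy.
apply: IH => // [|z /dX]; first by rewrite -dw.
by rewrite dw; apply: ltnW.
Qed.

(** Acyclicity of a connected graph as seen from a root: it turns questions about cycles into
    questions about levels. *)
Definition rooted_forest x : Prop :=
  (forall u v, g u v -> child g x u v || child g x v u) /\
  (forall w1 w2 v, child g x w1 v -> child g x w2 v -> w1 = w2).

Hypotheses (gS : symmetric g) (gI : irreflexive g).

Lemma avoid_sym (X : pred 'I_n) : symmetric (avoid X).
Proof. by move=> u v; rewrite /avoid /= gS; case: (X u); case: (X v). Qed.

(** Two distinct neighbours of [a] joined by a path off [a] would close a cycle through [a]. *)
Lemma acyclic_neighbours a b c : acyclic g -> g a b -> g a c ->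
  connect (avoid (pred1 a)) b c -> b = c.
Proof.
move=> gA gab gac /connectP[p0 gp0 cE]; rewrite {}cE in gac *.
move: gac; case/shortenP: gp0 => p gp up _ gac.
case: p gp up gac => //= y p /andP[] /and3P[gby bNa yNa] gp up gac.
have gpath : path g y p by apply: sub_path gp => u v /and3P[].
have aNp : a \notin p.
  elim: p y {bNa yNa up gpath gby gac} gp => //= z p IH y /andP[/and3P[_ _ zNa]] /IH.
  by rewrite inE negb_or eq_sym zNa.
have ua : uniq [:: a, b, y & p].
  by rewrite cons_uniq !inE !negb_or eq_sym bNa [a == y]eq_sym yNa aNp.
by have := gA a [:: b, y & p] ua isT; rewrite /= gab gby gpath gS gac => /(_ isT).
Qed.

(** A parent of [v] and any neighbour of [v] no farther from the root are both joined to the root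
    off [v], so they coincide. This is [up]. *)
Lemma tree_rooted x : acyclic g -> rooted_forest x.
Proof.
move=> gA.
have up v w u : child g x w v -> g v u -> dist g x u <= dist g x v -> w = u.
  move=> wv gvu du; have vx := child_neq_root wv.
  case/andP: wv => gwv /eqP dw.
  have uv : u != v by apply: contraTneq gvu => ->; rewrite gI.
  have wv : w != v by apply: contraTneq gwv => ->; rewrite gI.
  apply: (acyclic_neighbours gA (a := v)) => //; first by rewrite gS.
  apply: connect_trans (_ : connect _ w x) (_ : connect _ x u).
    rewrite (sym_connect_sym (avoid_sym _)).
    by apply: connect_avoid; rewrite //= ?wv 1?eq_sym // => z /eqP->; rewrite dw.
  by apply: connect_avoid; rewrite //= ?uv 1?eq_sym // => z /eqP->.
split=> [u v guv|w1 w2 v c1 c2]; last first.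
  apply: (up v) => //; first by case/andP: c2; rewrite gS.
  by case/andP: c2 => _ /eqP ->.
rewrite /child guv gS guv /=.
have [duv|dvu|duv] := ltngtP (dist g x u) (dist g x v).
- by rewrite eqn_leq duv dist_edge.
- by apply/orP; right; rewrite eqn_leq dvu dist_edge // gS.
(* An edge within a level is excluded: by [up] the parent of [v] would be [u], which lies on the
   level of [v] itself. *)
have [vx|vx] := eqVneq v x.
  move: duv; rewrite vx distxx => /eqP; rewrite dist_eq0 => /eqP ux.
  by move: guv; rewrite ux vx gI.
have [w wv] := ex_parent vx.
have wu : w = u by apply: (up v); rewrite ?duv // gS.
by case/andP: wv => _; rewrite wu duv => /eqP/n_Sn.
Qed.

(** On a cycle, both neighbours of a vertex farthest from the root would have to be its parent. The
    cycle is rotated to start at such a vertex. *)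
Lemma rooted_acyclic x : rooted_forest x -> acyclic g.
Proof.
move=> [edge uniq_par] z s us s2 gs; apply/negP => glast.
have gcyc : path.cycle g (z :: s) by rewrite /= rcons_path gs.
have [m ms dmax] : exists2 m, m \in z :: s & forall y, y \in z :: s -> dist g x y <= dist g x m.
  have [m ms dmax] := @arg_maxnP _ z (mem (z :: s)) (dist g x) (mem_head _ _).
  by exists m.
have [i s' rotE] := rot_to ms.
have := gcyc; rewrite -(rot_cycle i) rotE.
have us' : uniq (m :: s') by rewrite -rotE rot_uniq.
have ss' : size s' = size s by apply: succn_inj; rewrite -/(size (m :: s')) -rotE size_rot.
have dmax' y : y \in s' -> dist g x y <= dist g x m.
  by move=> ys; apply: dmax; rewrite -(mem_rot i) rotE inE ys orbT.
case: s' {rotE} us' ss' dmax' => [|a [|b s']]; try by move=> _ sE; move: s2; rewrite -sE.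
move=> us' _ dmax' /=; rewrite rcons_path => /and4P[gma _ _ gl].
have child_of y : y \in [:: a, b & s'] -> g m y -> child g x y m.
  move=> /dmax' dy /edge; rewrite /child => /orP[/andP[_ /eqP dE]|//].
  by move: dy; rewrite dE ltnn.
have lin : last b s' \in b :: s' by apply: mem_last.
have al : a = last b s'.
  apply: (uniq_par _ _ m); apply: child_of => //; rewrite ?mem_head //.
    by rewrite inE lin orbT.
  by rewrite gS.
by move: us'; rewrite [uniq _]/= al lin /= andbF.
Qed.

Lemma sum_neq1 x : \sum_v (v != x) = n.-1.
Proof.
rewrite -big_mkcond /= sum1_card.
have := cardC1 x; rewrite card_ord => <-.
by apply: eq_card => y; rewrite !inE.
Qed.

Lemma deg_sum v : deg g v = \sum_u (g v u).
Proof. by rewrite /deg -sum1_card -big_mkcond. Qed.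

(** Ordered edges point down, up, or neither way; the first two kinds are equinumerous. *)
Lemma degree_sum_children x :
  \sum_v deg g v = (\sum_v \sum_w child g x w v).*2 +
     \sum_v \sum_w (g v w && ~~ child g x w v && ~~ child g x v w).
Proof.
rewrite -addnn -{1}[\sum_v \sum_w child _ _ _ _]exchange_big /= -!big_split /=.
apply: eq_bigr => v _; rewrite -!big_split deg_sum /=; apply: eq_bigr => w _.
rewrite /child [g w v]gS; case: (g v w) => //=.
by case: eqP => [->|]; case: eqP => // /eqP; lia.
Qed.

Lemma parent_count x v : v != x -> 0 < \sum_w child g x w v.
Proof. by case/ex_parent => w wv; rewrite (bigD1 w) //= wv. Qed.

Lemma rooted_parents x v : rooted_forest x -> \sum_w child g x w v = (v != x).
Proof.
move=> [_ upar]; have [->|/ex_parent[w wv]] := eqVneq v x.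
  rewrite big1 // => w _; case: (boolP (child _ _ _ _)) => // /child_neq_root.
  by rewrite eqxx.
rewrite (bigD1 w) //= wv big1 // => u uw; case: (boolP (child _ _ _ _)) => // uv.
by rewrite (upar _ _ _ uv wv) eqxx in uw.
Qed.

Lemma rooted_degree_sum x : rooted_forest x -> \sum_v deg g v = (n.-1).*2.
Proof.
move=> gx; rewrite (degree_sum_children x) [X in _ + X]big1 => [|v _]; last first.
  by rewrite big1 // => w _; case: (boolP (g v w)) => //= /gx.1 /orP[] ->; rewrite ?andbF.
rewrite addn0; congr (_.*2); rewrite -(sum_neq1 x); apply: eq_bigr => v _.
exact: rooted_parents.
Qed.

(** Each vertex other than the root has at least one parent, which already accounts for the whole
    degree sum; nothing is left for second parents or for edges within a level. *)
Lemma degree_sum_rooted x : \sum_v deg g v = (n.-1).*2 -> rooted_forest x.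
Proof.
rewrite (degree_sum_children x) -(sum_neq1 x).
have np v : (v != x) <= \sum_w child g x w v.
  by case: (eqVneq v x) => //= /parent_count.
have npE : \sum_v \sum_w child g x w v =
    \sum_v (v != x) + \sum_v (\sum_w child g x w v - (v != x)).
  by rewrite -big_split; apply: eq_bigr => v _ /=; rewrite subnKC.
rewrite npE => sumE.
have /eqP : \sum_v (\sum_w child g x w v - (v != x)) = 0 by move: sumE; lia.
have /eqP : \sum_v \sum_w (g v w && ~~ child g x w v && ~~ child g x v w) = 0.
  by move: sumE; lia.
rewrite !sum_nat_eq0 => /forallP e0 /forallP p0; split=> [u v guv|w1 w2 v c1 c2].
  have := e0 u; rewrite sum_nat_eq0 => /forallP/(_ v) /=.
  by rewrite guv eqb0 /= -negb_or negbK orbC.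
apply/eqP; apply/negPn/negP => w12; have /= := p0 v.
rewrite (bigD1 w1) //= c1 (bigD1 w2) 1?eq_sym //= c2.
by rewrite (child_neq_root c1).
Qed.
End RootedGraphs.

(** Acyclicity is traded for a degree count, which exchanges of edges preserve; after an exchange
    the real work is then connectedness alone. *)
Lemma is_treeP n (g : rel 'I_n) :
  is_tree g <->
  [/\ 0 < n, symmetric g, irreflexive g, connected g & \sum_v deg g v = (n.-1).*2].
Proof.
split=> [[n_gt0 [[gS gI] [gC gA]]]|[n_gt0 gS gI gC gd]].
  split=> //; apply: (rooted_degree_sum gC gS (x := Ordinal n_gt0)).
  exact: tree_rooted.
split=> //; split=> //; split=> //; apply: (rooted_acyclic gS (x := Ordinal n_gt0)).
exact: degree_sum_rooted.
Qed.

(** * Exchanging edges *)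

Section Rewire.
Variable n : nat.
Implicit Types (g : rel 'I_n) (a b c d u v w x y : 'I_n).

Definition pairb a b : rel 'I_n :=
  [rel x y | (x == a) && (y == b) || (x == b) && (y == a)].

(** The end [u] of the edge [u w] is moved to [v]. All exchanges below are composed of this move. *)
Definition rewire g u w v : rel 'I_n :=
  [rel x y | g x y && ~~ pairb u w x y || pairb v w x y].

Lemma pairb_sym a b : symmetric (pairb a b).
Proof. by move=> x y; rewrite /pairb /= orbC [(x == b) && _]andbC [(y == b) && _]andbC. Qed.

Lemma rewire_sym g u w v : symmetric g -> symmetric (rewire g u w v).
Proof.
by move=> gS x y; rewrite /rewire /= gS (pairb_sym u w x y) (pairb_sym v w x y).
Qed.

Lemma rewire_irr g u w v : irreflexive g -> v != w -> irreflexive (rewire g u w v).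
Proof.
move=> gI vw x; rewrite /rewire /pairb /= gI /=.
rewrite [(x == w) && _]andbC orbb; apply/negbTE/negP => /andP[/eqP-> /eqP vE].
by rewrite vE eqxx in vw.
Qed.

Section RewireSums.
Variable R : numDomainType.
Local Open Scope ring_scope.
Implicit Types phi : 'I_n -> R.

Lemma sum_eq1 u phi : \sum_x (x == u)%:R * phi x = phi u.
Proof.
rewrite (bigD1 u) //= eqxx mul1r big1 ?addr0 // => x /negbTE->.
by rewrite mul0r.
Qed.

Lemma sum_pairb a b phi x : a != b ->
  \sum_y (pairb a b x y)%:R * phi y = (x == a)%:R * phi b + (x == b)%:R * phi a.
Proof.
move=> ab; transitivity (\sum_y ((x == a)%:R * ((y == b)%:R * phi y) +
                                (x == b)%:R * ((y == a)%:R * phi y))).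
  apply: eq_bigr => y _; rewrite /pairb /=.
  have [->|_] := eqVneq x a; first rewrite (negbTE ab).
    by rewrite /= orbF mul1r mul0r addr0.
  by case: (x == b); rewrite /= ?mul1r ?mul0r ?add0r.
by rewrite big_split /= -!mulr_sumr !sum_eq1.
Qed.

Variables (g : rel 'I_n) (u w v : 'I_n).
Hypotheses (gS : symmetric g) (uw : u != w) (vw : v != w).
Hypotheses (guw : g u w) (gvw : ~~ g v w).

(** As an additive identity between indicators, this lets degrees and neighbour sums follow by
    linearity. *)
Lemma rewireE x y : (rewire g u w v x y)%:R =
  (g x y)%:R - (pairb u w x y)%:R + (pairb v w x y)%:R :> R.
Proof.
have uv : u != v by apply: contraNneq gvw => <-.
rewrite /rewire /=.
have [puw|/= _] := boolP (pairb u w x y); last first.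
  have [pvw|_] := boolP (pairb v w x y); last by rewrite andbT orbF subr0 addr0.
  suff /negbTE-> : ~~ g x y by rewrite subr0 add0r.
  by case/orP: pvw => /andP[/eqP-> /eqP->] //; rewrite gS.
have -> : g x y by case/orP: puw => /andP[/eqP-> /eqP->] //; rewrite gS.
suff /negbTE-> : ~~ pairb v w x y by rewrite /= subrr addr0.
case/orP: puw => /andP[/eqP-> /eqP->]; rewrite /pairb /=.
  by rewrite (negbTE uv) (negbTE uw).
by rewrite (negbTE uv) (negbTE uw) !andbF.
Qed.

Lemma rewire_sum phi x :
  \sum_y (rewire g u w v x y)%:R * phi y =
  \sum_y (g x y)%:R * phi y - ((x == u)%:R * phi w + (x == w)%:R * phi u)
    + ((x == v)%:R * phi w + (x == w)%:R * phi v).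
Proof.
under eq_bigr do rewrite rewireE mulrDl mulrBl.
by rewrite big_split sumrB /= !sum_pairb.
Qed.
End RewireSums.

Lemma natr_deg (R : numDomainType) g x : ((deg g x)%:R = \sum_y (g x y)%:R * 1 :> R)%R.
Proof. by rewrite deg_sum natr_sum; apply: eq_bigr => y _; rewrite mulr1. Qed.

Lemma rewire_deg g u w v x : symmetric g -> u != w -> v != w -> g u w -> ~~ g v w ->
  deg (rewire g u w v) x + (x == u) = deg g x + (x == v).
Proof.
move=> gS uw vw guw gvw; apply/eqP; rewrite -(eqr_nat int) !natrD !natr_deg.
by rewrite rewire_sum // !mulr1; apply/eqP; ring.
Qed.

Lemma rewire_degree_sum g u w v :
  symmetric g -> u != w -> v != w -> g u w -> ~~ g v w ->
  \sum_x deg (rewire g u w v) x = \sum_x deg g x.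
Proof.
move=> gS uw vw guw gvw; apply: (@addIn 1).
have s1 (z : 'I_n) : \sum_x (x == z) = 1.
  by rewrite (bigD1 z) //= eqxx big1 // => x /negbTE->.
rewrite -{1}(s1 u) -(s1 v) -!big_split; apply: eq_bigr => x _ /=.
exact: rewire_deg.
Qed.

Lemma connected_sub g h : connected g -> (forall x y, g x y -> connect h x y) ->
  connected h.
Proof. by move=> gC gh x y; apply: connect_sub gh _ _ (gC x y). Qed.

Lemma connect_avoidN g X x y : connect (avoid g X) x y -> x != y -> ~~ X x && ~~ X y.
Proof.
move=> /connectP[p gp ->]; case/lastP: p gp => [|p z]; first by rewrite eqxx.
rewrite last_rcons => gp _; apply/andP; split.
  by case: p gp => [|t p] /= /andP[/and3P[]].
by move: gp; rewrite rcons_path => /andP[_ /and3P[]].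
Qed.

(** Seen from [v], cutting off the child [w] of [u] leaves [u] joined to [v] by a path that misses
    [w]; the new edge joins [w] back. *)
Lemma rewire_tree g u w v : is_tree g -> v != u -> child g v u w ->
  ~~ g v w /\ is_tree (rewire g u w v).
Proof.
move=> gT vu uw; have [n_gt0 gS gI gC gd] := (is_treeP g).1 gT.
have [edge upar] := tree_rooted gC gS gI v gT.2.2.2.
have wv := child_neq_root gC uw; case/andP: (uw) => guw /eqP dw.
have uNw : u != w by apply: contraTneq guw => ->; rewrite gI.
have gvw : ~~ g v w.
  apply/negP => /edge/orP[cvw|]; last by move/(child_neq_root gC); rewrite eqxx.
  by move: vu; rewrite (upar _ _ _ cvw uw) eqxx.
split=> //; apply/is_treeP; split=> //.
- exact: rewire_sym.
- by apply: rewire_irr; rewrite // eq_sym.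
- have rS : connect_sym (rewire g u w v) by apply/sym_connect_sym/rewire_sym.
  have cuw : connect (rewire g u w v) u w.
    apply: connect_trans (_ : connect _ v w); last first.
      by apply: connect1; rewrite /rewire /pairb /= !eqxx orbT.
    rewrite rS; apply: connect_sub (_ : connect (avoid g (pred1 w)) v u).
      move=> x y /and3P[gxy /= xw yw]; apply: connect1.
      by rewrite /rewire /pairb /= gxy (negbTE xw) (negbTE yw) !andbF.
    by apply: connect_avoid; rewrite //= ?uNw 1?eq_sym // => z /eqP->; rewrite dw.
  apply: connected_sub gC _ => x y gxy.
  have [|nxy] := boolP (pairb u w x y).
    by case/orP=> /andP[/eqP-> /eqP->] //; rewrite rS.
  by apply: connect1; rewrite /rewire /= gxy nxy.
- by rewrite rewire_degree_sum // eq_sym.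
Qed.

(* The edges [a b] and [c d] are replaced by [a c] and [b d]. *)
Definition swap g a b c d : rel 'I_n := rewire (rewire g a b d) d c a.

Section Swap.
Variables (g : rel 'I_n) (a b c d : 'I_n).
Hypotheses (gT : is_tree g) (gab : g a b) (gcd : g c d) (bc : b != c).
Hypothesis con : connect (avoid g (pred2 a d)) b c.

Let gS : symmetric g. Proof. by case: gT => _ [[]]. Qed.
Let gI : irreflexive g. Proof. by case: gT => _ [[]]. Qed.

Let con1 e : (e == a) || (e == d) -> connect (avoid g (pred1 e)) b c.
Proof.
move=> ad; apply: connect_sub con => x y /and3P[gxy /= xX yX].
apply: connect1; rewrite /avoid /= gxy /=.
by apply/andP; split; [move: xX|move: yX]; apply: contra => /eqP->.
Qed.

(** If [a] and [d] coincided, [b] and [c] would be two neighbours of one vertex joined by a path off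
    it. The next lemma excludes chords in the same way. *)
Lemma swap_neq : [/\ a != b, a != c, d != b, d != c & a != d].
Proof.
have /= := connect_avoidN con bc; rewrite !negb_or => /andP[/andP[ba bd] /andP[ca cd]].
split; rewrite 1?eq_sym //; apply: contra_neq bc => da.
apply: (acyclic_neighbours gS gT.2.2.2 gab) => //; first by rewrite gS -da.
by apply: con1; rewrite eqxx.
Qed.

Lemma swap_nedge : ~~ g d b /\ ~~ g a c.
Proof.
split; apply: contra bc => ge; apply/eqP.
  apply: (acyclic_neighbours gS gT.2.2.2 ge); first by rewrite gS.
  by apply: con1; rewrite eqxx orbT.
apply: (acyclic_neighbours gS gT.2.2.2 gab) => //.
by apply: con1; rewrite eqxx.
Qed.

Let g1 := rewire g a b d.
Let g1S : symmetric g1. Proof. exact: rewire_sym. Qed.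

Let g1dc : g1 d c.
Proof.
have [ab ac db dc ad] := swap_neq; rewrite /g1 /rewire /pairb /= gS gcd.
by rewrite (negbTE db) eq_sym (negbTE ad).
Qed.

Let g1ac : ~~ g1 a c.
Proof.
have [ab ac db dc ad] := swap_neq; rewrite /g1 /rewire /pairb /=.
by rewrite (negbTE swap_nedge.2) (negbTE ad) (negbTE ab).
Qed.

Lemma swap_deg x : deg (swap g a b c d) x = deg g x.
Proof.
have [ab ac db dc ad] := swap_neq; have [gdb gac] := swap_nedge.
(* The first rewiring moves one unit of degree from [a] to [d], the second moves it back. *)
by apply: (@addIn (x == d)); rewrite !rewire_deg.
Qed.

(** The path from [b] to [c] survives the swap; prolonged by the new edges it joins the ends of both
    deleted edges. *)
Lemma swap_tree : is_tree (swap g a b c d).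
Proof.
have [ab ac db dc ad] := swap_neq; have [gdb gac] := swap_nedge.
have [n_gt0 _ _ gC gd] := (is_treeP g).1 gT.
apply/is_treeP; split=> //.
- exact: rewire_sym.
- by apply: rewire_irr => //; apply: rewire_irr.
- have swS : symmetric (swap g a b c d) by apply: rewire_sym.
  have rS := sym_connect_sym swS.
  have sac : swap g a b c d a c by rewrite /swap /rewire /pairb /= !eqxx orbT.
  have sdb : swap g a b c d d b.
    by rewrite /swap /rewire /pairb /= !eqxx orbT (negbTE bc) (negbTE dc).
  have sbc : connect (swap g a b c d) b c.
    apply: connect_sub con => x y /and3P[gxy /=]; rewrite !negb_or.
    move=> /andP[xa xd] /andP[ya yd]; apply: connect1.
    by rewrite /swap /rewire /pairb /= gxy (negbTE xa) (negbTE xd) (negbTE ya) (negbTE yd) !andbF.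
  have sab : connect (swap g a b c d) a b.
    by apply: connect_trans (connect1 sac) _; rewrite rS.
  have sdc : connect (swap g a b c d) d c.
    by apply: connect_trans (connect1 sdb) _.
  apply: connected_sub gC _ => x y gxy.
  have [|nab] := boolP (pairb a b x y).
    by case/orP=> /andP[/eqP-> /eqP->] //; rewrite rS.
  have [|ndc] := boolP (pairb d c x y).
    by case/orP=> /andP[/eqP-> /eqP->] //; rewrite rS.
  by apply: connect1; rewrite /swap /rewire /= gxy nab ndc.
- by rewrite -gd; apply: eq_bigr => x _; apply: swap_deg.
Qed.

Variable R : rcfType.
Local Open Scope ring_scope.
Implicit Type f : 'I_n -> R.

Lemma swap_signless f x :
  signless (swap g a b c d) f x = signless g f x
   + ((x == a)%:R * (f c - f b) + (x == d)%:R * (f b - f c)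
      + (x == b)%:R * (f d - f a) + (x == c)%:R * (f a - f d)).
Proof.
have [ab ac db dc ad] := swap_neq; have [gdb gac] := swap_nedge.
rewrite /signless /nbsum swap_deg /swap !rewire_sum //; ring.
Qed.

Lemma swap_qform f :
  qform (swap g a b c d) f = qform g f + 2 * ((f a - f d) * (f c - f b)).
Proof.
rewrite /qform.
under eq_bigr do rewrite swap_signless mulrDr.
rewrite big_split /=; congr (_ + _).
transitivity (\sum_x ((x == a)%:R * (f x * (f c - f b)) + (x == d)%:R * (f x * (f b - f c))
   + (x == b)%:R * (f x * (f d - f a)) + (x == c)%:R * (f x * (f a - f d)))).
  by apply: eq_bigr => x _; ring.
rewrite !big_split /= !sum_eq1; ring.
Qed.
End Swap.

Section RewireForm.
Variables (R : rcfType) (g : rel 'I_n) (u w v : 'I_n).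
Local Open Scope ring_scope.
Hypotheses (gS : symmetric g) (uw : u != w) (vw : v != w).
Hypotheses (guw : g u w) (gvw : ~~ g v w).
Implicit Type f : 'I_n -> R.

Lemma rewire_signless f x : signless (rewire g u w v) f x = signless g f x
  + ((x == v)%:R * (f v + f w) - (x == u)%:R * (f u + f w) + (x == w)%:R * (f v - f u)).
Proof.
have /(congr1 (fun k => k%:R : R)) := rewire_deg x gS uw vw guw gvw.
rewrite !natrD => degE; rewrite /signless /nbsum rewire_sum //.
have -> : (deg (rewire g u w v) x)%:R = (deg g x)%:R + (x == v)%:R - (x == u)%:R :> R.
  by rewrite -degE addrK.
have ev : (x == v)%:R * f x = (x == v)%:R * f v by case: eqP => [->|]; rewrite ?mul0r.
have eu : (x == u)%:R * f x = (x == u)%:R * f u by case: eqP => [->|]; rewrite ?mul0r.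
by rewrite mulrBl mulrDl ev eu; ring.
Qed.

Lemma rewire_qform f : qform (rewire g u w v) f =
  qform g f + (f v - f u) * (f v + f u + 2 * f w).
Proof.
rewrite /qform.
under eq_bigr do rewrite rewire_signless mulrDr.
rewrite big_split /=; congr (_ + _).
transitivity (\sum_x ((x == v)%:R * (f x * (f v + f w)) + (x == u)%:R * (f x * - (f u + f w))
   + (x == w)%:R * (f x * (f v - f u)))).
  by apply: eq_bigr => x _; ring.
rewrite !big_split /= !sum_eq1; ring.
Qed.
End RewireForm.
End Rewire.

(** * Extremal trees *)

Section Shift.
Local Open Scope ring_scope.

Lemma rooted_ex_child n (g : rel 'I_n) x u : rooted_forest g x ->
  (1 < deg g u)%N -> exists w, child g x u w.
Proof.
move=> [edge upar] /card_gt1P[y [z [gy gz yz]]].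
case/orP: (edge _ _ gy) => [uy|yu]; first by exists y.
case/orP: (edge _ _ gz) => [uz|zu]; first by exists z.
by rewrite (upar _ _ _ yu zu) eqxx in yz.
Qed.

(** Children of [u], seen from the root [v], are moved to [v] one at a time; one is available while
    the degree exceeds 1. The last clause records a loss at [u], strict for positive [k], that will
    contradict [extremal_signless]. *)
Lemma shift_edges (R : rcfType) n (g : rel 'I_n) (f : 'I_n -> R) u v k :
  is_tree g -> v != u -> (forall x, 0 < f x) -> f u <= f v -> (k < deg g u)%N ->
  exists h : rel 'I_n,
    [/\ is_tree h, forall x, (deg h x + k * (x == u) = deg g x + k * (x == v))%N,
        qform g f <= qform h f & signless h f u + k%:R * f u <= signless g f u].
Proof.
move=> gT vu f_gt0 fuv; elim: k => [|k IH] kd.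
  by exists g; split=> //; rewrite mul0r addr0.
have [h [hT hd hq hs]] := IH (ltnW kd).
have [n_gt0 hS hI hC _] := (is_treeP h).1 hT.
have uv : (u == v) = false by rewrite eq_sym (negbTE vu).
have du : (1 < deg h u)%N.
  have := hd u; rewrite eqxx uv muln1 muln0 addn0 => hdu.
  by rewrite -(ltn_add2r k) hdu add1n.
have [w uw] := rooted_ex_child (tree_rooted hC hS hI v hT.2.2.2) du.
have [hvw h'T] := rewire_tree hT vu uw.
have wv := child_neq_root hC uw; have /andP[huw _] := uw.
have uNw : u != w by apply: contraTneq huw => ->; rewrite hI.
have vw : v != w by rewrite eq_sym.
exists (rewire h u w v); split=> //.
- move=> x; rewrite !mulSn addnA rewire_deg // [(deg h x + _)%N]addnC -addnA hd.
  by rewrite addnA [(_ + deg g x)%N]addnC -addnA.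
- rewrite rewire_qform //; apply: le_trans hq _; rewrite lerDl mulr_ge0 ?subr_ge0 //.
  by have := f_gt0 u; have := f_gt0 v; have := f_gt0 w; lra.
- rewrite rewire_signless // eqxx uv (negbTE uNw) !mul0r mul1r -natr1 mulrDl mul1r.
  by have := f_gt0 w; lra.
Qed.

End Shift.

Section Extremal.
Local Open Scope ring_scope.
Variables (R : rcfType) (n : nat) (g : rel 'I_n) (l : R) (f : 'I_n -> R).
Hypotheses (gT : is_tree g) (gf : perron g l f).
Hypothesis ext : perron_maximal g l.

Let n_gt0 : (0 < n)%N. Proof. by case: gT. Qed.
Let gS : symmetric g. Proof. by case: gT => _ [[]]. Qed.
Let gI : irreflexive g. Proof. by case: gT => _ [[]]. Qed.
Let gC : connected g. Proof. by case: gT => _ [_ []]. Qed.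
Let gA : acyclic g. Proof. by case: gT => _ [_ []]. Qed.
Let f_gt0 v : 0 < f v. Proof. by case: gf. Qed.

(** With [l'] the Perron root of [h], the chain [l |f|^2 = qform g f <= qform h f <= l' |f|^2 <= l
    |f|^2] collapses, so [f] is an eigenvector for [h] with the same eigenvalue. *)
Lemma extremal_signless (h : rel 'I_n) : is_tree h ->
  perm_eq (degrees h) (degrees g) ->
  qform g f <= qform h f -> forall v, signless h f v = signless g f v.
Proof.
move=> hT hd hq; have [_ hS hI hC _] := (is_treeP h).1 hT.
have [l' [f' pf']] := perron_exists R n_gt0 (conj hS hI) hC.
have ll' := ext hT hd pf'.
have sq_gt0 : 0 < sqnorm f.
  by apply: sqnorm_gt0; exists (Ordinal n_gt0); rewrite gt_eqF.
have qg := qform_eigen gf.2; have rh := perron_rayleigh f hS pf'.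
have lE : l' = l.
  apply/eqP; rewrite eq_le ll' /= -(ler_pM2r sq_gt0) -qg.
  exact: le_trans hq rh.
move=> v; rewrite gf.2 -lE; apply: (perron_rayleigh_eigen n_gt0 hS hC pf').
by apply/eqP; rewrite eq_le rh lE -qg hq.
Qed.

Lemma extremal_deg u v : (deg g v < deg g u)%N -> f v < f u.
Proof.
move=> duv; rewrite ltNge; apply/negP => fuv.
have vu : v != u by apply: contraTneq duv => ->; rewrite ltnn.
have uv : (u == v) = false by rewrite eq_sym (negbTE vu).
have dv : (0 < deg g v)%N.
  have [w /andP[gwv _]] := ex_parent gC vu.
  by apply/card_gt0P; exists w; rewrite inE gS.
(* Moving this many edges interchanges the degrees of [u] and [v], so the degree sequence is kept;
   [v] is not isolated, so [u] has enough edges to give. *)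
have kd : (deg g u - deg g v < deg g u)%N.
  by rewrite ltn_subrL dv (leq_trans dv (ltnW duv)).
have [h [hT hd hq hs]] := shift_edges gT vu f_gt0 fuv kd.
have hd' x : deg h x = deg g (tperm u v x).
  have := hd x; case: tpermP => [->|->|/eqP/negbTE xu /eqP/negbTE xv].
  - rewrite eqxx uv muln1 muln0 addn0 => e; apply: (@addIn (deg g u - deg g v)%N).
    by rewrite e subnKC // ltnW.
  - by rewrite eqxx (negbTE vu) muln1 muln0 addn0 => ->; rewrite subnKC // ltnW.
  - by rewrite xu xv muln0 !addn0.
have hp : perm_eq (degrees h) (degrees g).
  rewrite /degrees (eq_map hd') (map_comp (deg g) (tperm u v)); apply: perm_map.
  apply: uniq_perm; first by rewrite (map_inj_uniq (@perm_inj _ _)) enum_uniq.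
    exact: enum_uniq.
  move=> x; rewrite mem_enum; apply/mapP; exists (tperm u v x).
    by rewrite mem_enum.
  by rewrite tpermK.
move: hs; rewrite (extremal_signless hT hp hq) gerDl leNgt.
by rewrite mulr_gt0 // ltr0n subn_gt0.
Qed.

Section Swapping.
Variables (a b c d : 'I_n).
Hypotheses (gab : g a b) (gcd : g c d) (bc : b != c).
Hypothesis con : connect (avoid g (pred2 a d)) b c.

(** The swap does not lower the form, so the signless values are unchanged; at [b] they differ by
    [f d - f a], at [a] by [f c - f b]. *)
Lemma extremal_swap : 0 <= (f a - f d) * (f c - f b) -> f a = f d /\ f b = f c.
Proof.
move=> prod_ge0; have swT := swap_tree gT gab gcd bc con.
have [ab ac db dc ad] := swap_neq gT gab gcd bc con.
have swq : qform g f <= qform (swap g a b c d) f.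
  by rewrite swap_qform // lerDl mulr_ge0.
have swd : perm_eq (degrees (swap g a b c d)) (degrees g).
  by rewrite /degrees (eq_map (swap_deg gT gab gcd bc con)).
have eqs := extremal_signless swT swd swq.
split; [have := eqs b|have := eqs a]; rewrite swap_signless // eqxx.
  rewrite [b == a]eq_sym [b == d]eq_sym (negbTE ab) (negbTE db) (negbTE bc).
  by rewrite !mul0r mul1r; lra.
by rewrite (negbTE ab) (negbTE ac) (negbTE ad) !mul0r mul1r; lra.
Qed.

Lemma extremal_swap_le : f b <= f c -> f a <= f d.
Proof.
move=> fbc; rewrite leNgt; apply/negP => fda.
have [] := extremal_swap; last by lra.
by rewrite mulr_ge0 // subr_ge0 // ltW.
Qed.

Lemma extremal_swap_lt : f b < f c -> f a < f d.
Proof.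
move=> fbc; rewrite ltNge; apply/negP => fda.
have [] := extremal_swap; last by lra.
by rewrite mulr_ge0 // subr_ge0 // ltW.
Qed.
End Swapping.

Section Rooted.
Variable x : 'I_n.
Hypothesis fmax : forall v, f v <= f x.

Let gx : rooted_forest g x := tree_rooted gC gS gI x gA.
Local Notation band lo hi := (avoid g [pred z | ~~ (lo <= dist g x z <= hi)%N]).

(* If [f q < f p], the swap inequality propagates along the path outwards on both
   sides, until it contradicts the maximality of [f] at the root. *)
Lemma extremal_no_ascent q p : (dist g x q < dist g x p)%N ->
  connect (band (dist g x q) (dist g x p)) q p -> f p <= f q.
Proof.
move E: (dist g x q) => k; elim: k q p E => [|k IH] q p dq dp con.
  by move/eqP: dq; rewrite dist_eq0 // => /eqP->.
rewrite leNgt; apply/negP => fqp.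
have qx : q != x by rewrite -(dist_eq0 gC) dq.
have px : p != x by rewrite -(dist_eq0 gC); case: (dist g x p) dp.
have qp : q != p by apply: contraTneq dp => <-; rewrite dq ltnn.
have [q' cq] := ex_parent gC qx; have /andP[gq /eqP dq'] := cq.
(* Besides its parent, [q] has the next vertex of the path as a neighbour. Since [f q < f p], the
   degree of [p] is at least as large, which gives [p] a child. *)
have dq2 : (1 < deg g q)%N.
  have /connectP[[|y s] /= ps pl] := con; first by rewrite pl eqxx in qp.
  case/andP: ps => /and3P[gqy _ /=]; rewrite negbK => /andP[dy _] _.
  apply/card_gt1P; exists q', y; split; rewrite ?inE ?[g q q']gS //.
  by apply: contraTneq dy => <-; rewrite -dq dq' ltnn.
have dpq : (deg g q <= deg g p)%N.
  by rewrite leqNgt; apply: contraTN fqp => /extremal_deg; rewrite -leNgt; apply: ltW.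
have [p' cp] := rooted_ex_child gx (leq_trans dq2 dpq).
have /andP[gp /eqP dp'] := cp.
(* The path stays in the band, so it misses [q'] and [p'], which lie one level outside on either
   side. *)
have fq'p' : f q' < f p'.
  apply: (extremal_swap_lt gq gp qp) fqp.
  apply: connect_sub con => y z /and3P[gyz /=]; rewrite !negbK.
  move=> /andP[y1 y2] /andP[z1 z2]; apply: connect1; rewrite /avoid /= gyz.
  have ne w : (k < dist g x w)%N -> (dist g x w <= dist g x p)%N -> ~~ ((w == q') || (w == p')).
    move=> w1 w2; apply/negP => /orP[] /eqP wE.
      by move: dq'; rewrite dq -wE => - [kw]; rewrite kw ltnn in w1.
    by move: w2; rewrite wE dp' ltnn.
  by rewrite !ne.
have dk : dist g x q' = k by apply: succn_inj; rewrite -dq'.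
have kp : (k <= dist g x p)%N := ltnW (ltnW dp).
(* The induction hypothesis applies to [q'] and [p'], joined within the band widened by one level on
   both sides. *)
move: fq'p'; rewrite ltNge IH //; first by rewrite dp'.
apply: connect_trans (connect_trans (_ : connect _ q' q) (_ : connect _ q p)) _.
- by apply: connect1; rewrite /avoid /= gq dk dq dp' !negbK leqnn leqnSn (leqW kp) ltnS kp.
- apply: connect_sub con => y z /and3P[gyz /=]; rewrite !negbK.
  move=> /andP[y1 y2] /andP[z1 z2]; apply: connect1; rewrite /avoid /= gyz !negbK.
  by rewrite dp' (ltnW y1) (ltnW z1) (leqW y2) (leqW z2).
- by apply: connect1; rewrite /avoid /= gp !negbK dp' !leqnn leqnSn kp (leqW kp).
Qed.

Lemma extremal_parent w v : child g x w v -> f v <= f w.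
Proof.
case/andP=> gwv /eqP dv; apply: extremal_no_ascent; first by rewrite dv.
by apply: connect1; rewrite /avoid /= gwv dv !leqnn leqnSn.
Qed.

(** The parents are joined through the root by a path off [u] and [v], so the two parent edges can
    be swapped. The level conditions allow the levels of [u] and [v] to differ by one. *)
Lemma extremal_cousins pu pv u v : child g x pu u -> child g x pv v ->
  (dist g x pu <= dist g x v)%N -> (dist g x pv <= dist g x u)%N ->
  pu != v -> pv != u -> pu != pv -> f pu <= f pv -> f u <= f v.
Proof.
move=> cu cv duv dvu puv pvu pupv.
have ux := child_neq_root gC cu; have vx := child_neq_root gC cv.
have /andP[gu /eqP du] := cu; have /andP[gv /eqP dv] := cv.
apply: extremal_swap_le => //; first by rewrite gS.
have puu : pu != u by apply: contraTneq gu => ->; rewrite gI.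
have pvv : pv != v by apply: contraTneq gv => ->; rewrite gI.
have xX : ~~ pred2 u v x by rewrite /= negb_or ![x == _]eq_sym ux.
apply: connect_trans (_ : connect _ pu x) (_ : connect _ x pv).
  rewrite (sym_connect_sym (avoid_sym gS _)).
  apply: connect_avoid => //; first by rewrite /= negb_or puu.
  by move=> z /orP[] /eqP-> //; rewrite du.
apply: connect_avoid => //; first by rewrite /= negb_or pvu.
by move=> z /orP[] /eqP-> //; rewrite dv.
Qed.

(** Consecutive levels are compared by induction through their parents; a larger gap is closed by
    climbing from [u], as [f] does not decrease towards the root. *)
Lemma extremal_level u v : (dist g x v < dist g x u)%N -> f u <= f v.
Proof.
have next k : forall u v, dist g x v = k -> dist g x u = k.+1 -> f u <= f v.
  elim: k {u v} => [|k IH] u v dv du.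
    by move/eqP: dv; rewrite dist_eq0 // => /eqP->.
  have vx : v != x by rewrite -(dist_eq0 gC) dv.
  have ux : u != x by rewrite -(dist_eq0 gC) du.
  have [pu cu] := ex_parent gC ux; have [pv cv] := ex_parent gC vx.
  have [<-|puv] := eqVneq pu v; first exact: extremal_parent.
  have /andP[gu /eqP dpu] := cu; have /andP[gv /eqP dpv] := cv.
  have dpu' : dist g x pu = k.+1 by apply: succn_inj; rewrite -dpu.
  have dpv' : dist g x pv = k by apply: succn_inj; rewrite -dpv.
  apply: (extremal_cousins cu cv) => //; first by rewrite dpu' dv.
  - by rewrite dpv' du ltnW.
  - by apply: contraTneq isT => e; move: du; rewrite -e dpv' => /eqP; rewrite ltn_eqF // ltnW.
  - by apply: contraTneq isT => e; move: dpu'; rewrite e dpv' => /eqP; rewrite ltn_eqF.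
  - exact: IH.
move E: (dist g x u) => m; elim: m u E => // m IH u du.
rewrite ltnS leq_eqVlt => /orP[/eqP dv|dv]; first by apply: (next m).
have ux : u != x by rewrite -(dist_eq0 gC) du.
have [pu cu] := ex_parent gC ux; apply: le_trans (extremal_parent cu) _.
by apply: IH => //; case/andP: cu => _ /eqP; rewrite du => - [].
Qed.
End Rooted.
End Extremal.

(** * Breadth-first orderings *)

Section Rank.
Variables (R : rcfType) (n : nat) (f : 'I_n -> R).

(** Sorting breaks the ties of [f], which makes this an injective refinement of the order by
    decreasing [f]. *)
Definition rank (v : 'I_n) : nat :=
  index v (sort (fun a b => f b <= f a)%R (enum 'I_n)).

Lemma rank_lt v : rank v < n.
Proof.
have vs : v \in sort (fun a b => f b <= f a)%R (enum 'I_n) by rewrite mem_sort mem_enum.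
by rewrite /rank -[X in _ < X]card_ord cardE -(size_sort (fun a b => f b <= f a)%R) index_mem.
Qed.

Lemma rank_inj : injective rank.
Proof. by move=> u v; apply: (index_inj u); rewrite mem_sort mem_enum. Qed.

Lemma rank_mono u v : rank u < rank v -> (f v <= f u)%R.
Proof.
apply: (@sorted_ltn_index _ (fun a b => f b <= f a)%R); rewrite ?mem_sort ?mem_enum //.
  by move=> b a c fba fcb; apply: le_trans fcb fba.
by apply: sort_sorted => a b; rewrite le_total.
Qed.
End Rank.

Section Key.
Variables (R : rcfType) (n : nat) (g : rel 'I_n) (f : 'I_n -> R) (x : 'I_n).
Hypothesis gT : is_tree g.

Let n_gt0 : (0 < n)%N. Proof. by case: gT. Qed.
Let gS : symmetric g. Proof. by case: gT => _ [[]]. Qed.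
Let gI : irreflexive g. Proof. by case: gT => _ [[]]. Qed.
Let gC : connected g. Proof. by case: gT => _ [_ []]. Qed.
Let gA : acyclic g. Proof. by case: gT => _ [_ []]. Qed.
Let gx : rooted_forest g x := tree_rooted gC gS gI x gA.

(** The default [x] is the value at the root, which has no parent. *)
Definition parent (v : 'I_n) : 'I_n := odflt x [pick w | child g x w v].

Lemma parentE w v : child g x w v -> parent v = w.
Proof.
move=> wv; rewrite /parent; case: pickP => [u uv|/(_ w)]; last by rewrite wv.
exact: gx.2 uv wv.
Qed.

Lemma child_parent v : v != x -> child g x (parent v) v.
Proof. by case/(ex_parent gC) => w wv; rewrite (parentE wv). Qed.

(* The path from the root to [v] read as a number in base [n.+1], with digits the
   ranks of its vertices: comparing keys is a breadth-first comparison. *)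
Fixpoint level_key (k : nat) (v : 'I_n) : nat :=
  if k is k'.+1 then level_key k' (parent v) * n.+1 + rank f v else 1.

Definition key v := level_key (dist g x v) v.

Lemma key_child w v : child g x w v -> key v = key w * n.+1 + rank f v.
Proof. by move=> wv; case/andP: (wv) => _ /eqP dv; rewrite /key dv /= (parentE wv). Qed.

(** The root contributes the leading digit 1 and ranks are smaller than the base, so the number of
    digits reveals the level. *)
Lemma key_bounds v : n.+1 ^ dist g x v <= key v < 2 * n.+1 ^ dist g x v.
Proof.
rewrite /key; move: (dist g x v) => k; elim: k v => [|k IH] v //=.
have /andP[lo hi] := IH (parent v); have rv := rank_lt f v.
rewrite expnS; apply/andP; split.
  by rewrite mulnC; apply: leq_trans (leq_addr _ _); rewrite leq_mul2r lo orbT.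
rewrite mulnCA [n.+1 * _]mulnC.
apply: leq_trans (_ : (level_key k (parent v)).+1 * n.+1 <= _).
  by rewrite mulSn addnC ltn_add2r ltnW.
by rewrite leq_mul2r hi orbT.
Qed.

Lemma key_level u v : dist g x u < dist g x v -> key u < key v.
Proof.
move=> duv; have /andP[_ hu] := key_bounds u; have /andP[lv _] := key_bounds v.
apply: leq_trans hu (leq_trans _ lv).
apply: leq_trans (_ : n.+1 ^ (dist g x u).+1 <= _).
  by rewrite expnS leq_mul2r ltnS n_gt0 orbT.
by rewrite leq_exp2l.
Qed.

Lemma key_dist u v : key u <= key v -> dist g x u <= dist g x v.
Proof. by rewrite leqNgt => kuv; rewrite leqNgt; apply: contra kuv => /key_level. Qed.

Lemma rank_mod v : rank f v = rank f v %% n.+1.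
Proof. by rewrite modn_small // ltnW // ltnS rank_lt. Qed.

(** Equal keys have equal last digits, and these are the ranks. *)
Lemma key_inj : injective key.
Proof.
move=> u v kuv; have duv : dist g x u = dist g x v.
  by apply/eqP; rewrite eqn_leq !key_dist ?kuv.
have [ux|ux] := eqVneq u x.
  by apply/eqP; rewrite ux eq_sym -(dist_eq0 gC) -duv ux distxx.
have vx : v != x by rewrite -(dist_eq0 gC) -duv dist_eq0.
apply: (@rank_inj R n f); move: kuv.
rewrite (key_child (child_parent ux)) (key_child (child_parent vx)).
by move/(congr1 (modn^~ n.+1)); rewrite !modnMDl -!rank_mod.
Qed.

Lemma key_children w1 w2 v1 v2 : child g x w1 v1 -> child g x w2 v2 ->
  key w1 < key w2 -> key v1 < key v2.
Proof.
move=> c1 c2 kw; rewrite (key_child c1) (key_child c2).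
apply: leq_trans (leq_addr _ _); apply: leq_trans (_ : (key w1).+1 * n.+1 <= _).
  by rewrite mulSn addnC ltn_add2r ltnW // ltnS rank_lt.
by rewrite leq_mul2r kw orbT.
Qed.

Definition key_order := sort (relpre key leq) (enum 'I_n).

Lemma prec_key_order u v : prec key_order u v = (key u < key v).
Proof.
have mono a b : prec key_order a b -> key a <= key b.
  apply: (@sorted_ltn_index _ (relpre key leq)); rewrite ?mem_sort ?mem_enum //.
    by move=> ? ? ?; apply: leq_trans.
  by apply: sort_sorted => ? ?; apply: leq_total.
apply/idP/idP => [puv|kuv].
  rewrite ltn_neqAle mono // andbT; apply: contraTneq puv => /key_inj->.
  by rewrite /prec ltnn.
rewrite /prec ltnNge leq_eqVlt negb_or; apply/andP; split; last first.
  by apply: contraTN kuv => /mono; rewrite -leqNgt.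
apply: contraTneq kuv => e; suff -> : u = v by rewrite ltnn.
by apply: (index_inj u _ _ (esym e)); rewrite ?mem_sort ?mem_enum.
Qed.

Lemma key_order_BFD : (forall u v, key v < key u -> deg g u <= deg g v) ->
  BFD_ordering g x key_order.
Proof.
move=> degs; have ps : perm_eq key_order (enum 'I_n) by rewrite perm_sort.
split=> //.
- case E: key_order => [//|y s] /=; apply/eqP/negPn/negP => yx.
  have : prec key_order x y.
    by rewrite prec_key_order key_level // distxx // lt0n dist_eq0.
  by rewrite /prec E /= eqxx.
- by move=> u v duv; rewrite prec_key_order key_level.
- by move=> w1 w2 v1 v2 c1 c2; rewrite !prec_key_order; apply: key_children.
- by move=> u v; rewrite prec_key_order; apply: degs.
Qed.
End Key.

Section ExtremalOrder.
Local Open Scope ring_scope.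
Variables (R : rcfType) (n : nat) (g : rel 'I_n) (l : R) (f : 'I_n -> R).
Hypotheses (gT : is_tree g) (gf : perron g l f).
Hypothesis ext : perron_maximal g l.

(** Different levels are settled by [extremal_level]. Within a level, siblings are ordered by rank,
    and other vertices inherit the order of their parents through [extremal_cousins]. *)
Lemma extremal_key x : (forall v, f v <= f x) ->
  forall u v, (key g f x u < key g f x v)%N -> f v <= f u.
Proof.
move=> fmax u v; have [n_gt0 gS gI gC _] := (is_treeP g).1 gT.
have [duv _|duv] := ltnP (dist g x u) (dist g x v); first exact: (extremal_level gT gf ext fmax).
move=> kuv; have {duv} : dist g x u = dist g x v.
  by apply/eqP; rewrite eqn_leq duv (key_dist gT (ltnW kuv)).
move E: (dist g x v) => k; elim: k u v E kuv => [|k IH] u v dv kuv du.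
  move/eqP: dv; rewrite dist_eq0 // => /eqP->.
  by move/eqP: du; rewrite dist_eq0 // => /eqP->.
have ux : u != x by rewrite -(dist_eq0 gC) du.
have vx : v != x by rewrite -(dist_eq0 gC) dv.
have cu := child_parent gT ux; have cv := child_parent gT vx.
move: kuv cu cv; set pu := parent g x u; set pv := parent g x v => kuv cu cv.
have dpu : dist g x pu = k by apply: succn_inj; case/andP: cu => _ /eqP <-.
have dpv : dist g x pv = k by apply: succn_inj; case/andP: cv => _ /eqP <-.
have [puv|puv] := eqVneq pu pv.
  apply: (@rank_mono _ _ f); move: kuv.
  by rewrite (key_child _ gT cu) (key_child _ gT cv) puv ltn_add2l.
apply: (extremal_cousins gT gf ext cv cu); rewrite ?dpu ?dpv ?du ?dv //.
- by apply: contraTneq isT => e; move: dpv; rewrite e du => /eqP; rewrite gtn_eqF.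
- by apply: contraTneq isT => e; move: dpu; rewrite e dv => /eqP; rewrite gtn_eqF.
- by rewrite eq_sym.
apply: IH => //; rewrite ltn_neqAle; apply/andP; split.
  by apply: contra_neq puv => /(key_inj gT).
rewrite leqNgt; apply/negP => /(key_children gT cv cu).
by rewrite ltnNge (ltnW kuv).
Qed.

Lemma extremal_BFD_ordering : exists (v0 : 'I_n) (s : seq 'I_n),
  BFD_ordering g v0 s /\ (forall u v, f v < f u -> prec s u v).
Proof.
have n_gt0 : (0 < n)%N by case: gT.
have [x fmax] : exists x, forall v, f v <= f x.
  exists [arg max_(i > Ordinal n_gt0) f i]%O => v.
  by case: arg_maxP => // j _ /(_ v isT).
exists x, (key_order g f x); split.
  apply: key_order_BFD => // u v kuv; have := extremal_key fmax kuv.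
  by rewrite leqNgt leNgt; apply: contra; apply: (extremal_deg gT gf ext).
move=> u v fvu; rewrite prec_key_order // ltnNge; apply: contraTN fvu => kvu.
rewrite -leNgt; move: kvu; rewrite leq_eqVlt => /orP[/eqP/(key_inj gT)->//|].
exact: extremal_key.
Qed.
End ExtremalOrder.

(** * The Laplacian of a tree *)

Section Laplacian.
Local Open Scope ring_scope.
Variables (R : rcfType) (n : nat) (g : rel 'I_n).
Hypothesis gT : is_tree g.

Let n_gt0 : (0 < n)%N. Proof. by case: gT. Qed.
Let gS : symmetric g. Proof. by case: gT => _ [[]]. Qed.
Let gI : irreflexive g. Proof. by case: gT => _ [[]]. Qed.
Let gC : connected g. Proof. by case: gT => _ [_ []]. Qed.
Let gA : acyclic g. Proof. by case: gT => _ [_ []]. Qed.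

(** The bipartition of the tree by signs, from an arbitrary base vertex: edges join consecutive
    levels. *)
Definition parity (v : 'I_n) : R := (-1) ^+ dist g (Ordinal n_gt0) v.

Lemma parity_edge u v : g u v -> parity u = - parity v.
Proof.
have [edge _] := tree_rooted gC gS gI (Ordinal n_gt0) gA.
by rewrite /parity => /edge/orP[] /andP[_ /eqP->]; rewrite exprS ?mulN1r ?opprK.
Qed.

Lemma norm_parity v : `|parity v| = 1.
Proof. by rewrite /parity normrX normrN1 expr1n. Qed.

Lemma parity_sq v : parity v * parity v = 1.
Proof. by rewrite /parity -expr2 sqrr_sign. Qed.

Lemma laplacian_signless (y : 'rV[R]_n) v :
  parity v * (y *m laplacian R g) ord0 v = signless g (fun u => parity u * y ord0 u) v.
Proof.
rewrite mxE mulr_sumr /signless /nbsum.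
transitivity (\sum_u ((u == v)%:R * ((deg g u)%:R * (parity u * y ord0 u))
                     + (g v u)%:R * (parity u * y ord0 u))).
  apply: eq_bigr => u _; rewrite !mxE gS.
  have [->|_] := eqVneq u v; first by rewrite gI /= mulr1n; ring.
  have [/parity_edge->|_] := boolP (g v u); last by rewrite /= !mulr0n; ring.
  by rewrite /= mulr0n mulr1n; ring.
by rewrite big_split /= sum_eq1.
Qed.

Lemma laplacian_eigen (y : 'rV[R]_n) (l : R) : y *m laplacian R g = l *: y <->
  forall v, signless g (fun u => parity u * y ord0 u) v = l * (parity v * y ord0 v).
Proof.
split=> [yE v|yE]; first by rewrite -laplacian_signless yE mxE; ring.
apply/rowP => v; have := yE v; rewrite -laplacian_signless [(l *: y) _ _]mxE => e.
by rewrite -[LHS]mul1r -(parity_sq v) -mulrA e -[RHS]mul1r -(parity_sq v); ring.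
Qed.

(** The sign change carries eigenvectors of the Laplacian to eigenvectors of the signless form,
    whose Rayleigh quotients are at most [l]; [f] itself attains [l]. *)
Lemma perron_largest_eig (l : R) f : perron g l f -> largest_eig (laplacian R g) l.
Proof.
move=> gf; have [f_gt0 fE] := gf; split.
  apply/eigenvalueP; exists (\row_v (parity v * f v)).
    have rowE u : parity u * (\row_v (parity v * f v)) ord0 u = f u.
      by rewrite mxE mulrA parity_sq mul1r.
    apply/laplacian_eigen => v; rewrite rowE -fE /signless rowE; congr (_ + _).
    by apply: eq_bigr => u _; rewrite rowE.
  apply/eqP => /rowP/(_ (Ordinal n_gt0))/eqP.
  by rewrite !mxE mulf_eq0 signr_eq0 gt_eqF.
move=> m /eigenvalueP[y /laplacian_eigen yE y0].
have y_gt0 : 0 < sqnorm (fun u => parity u * y ord0 u).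
  apply: sqnorm_gt0; have /rV0Pn[v yv] := y0.
  by exists v; rewrite mulf_neq0 ?signr_eq0.
rewrite -(ler_pM2r y_gt0) -(qform_eigen yE).
exact: perron_rayleigh gf.
Qed.

Lemma largest_eig_perron (l l' : R) f : largest_eig (laplacian R g) l ->
  perron g l' f -> l = l'.
Proof.
move=> [le lmax] /perron_largest_eig[le' lmax'].
by apply/eqP; rewrite eq_le lmax' // lmax.
Qed.

(** The sign-changed [y] attains the Rayleigh bound, so it is a multiple [c] of a positive
    eigenvector and [|y|] is [|c|] times it. *)
Lemma eigenvector_perron (l : R) (y : 'rV[R]_n) :
  largest_eig (laplacian R g) l -> eigenvector (laplacian R g) l y ->
  perron g l (fun v => `|y ord0 v|).
Proof.
move=> ll [y0 /laplacian_eigen yE].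
have [l' [f gf]] := perron_exists R n_gt0 (conj gS gI) gC.
have lE := largest_eig_perron ll gf; rewrite -{}lE in gf.
have [c cE] := perron_rayleigh_eq n_gt0 gS gC gf (qform_eigen yE).
have yc v : `|y ord0 v| = `|c| * f v.
  have /(congr1 Num.norm) := cE v; rewrite !normrM norm_parity mul1r => ->.
  by rewrite [`|f v|]gtr0_norm //; case: gf.
have c_gt0 : 0 < `|c|.
  rewrite normr_gt0; apply: contra_neq y0 => c0; apply/rowP => v.
  by apply/eqP; rewrite mxE -normr_eq0 yc c0 normr0 mul0r.
split=> v; first by rewrite yc mulr_gt0 //; case: gf.
by rewrite (signlessZ g yc) yc gf.2; ring.
Qed.
End Laplacian.

(** * Uniqueness of BFD-trees *)

Section Isomorphism.
Variables (R : rcfType) (n : nat) (g h : rel 'I_n) (sigma : {perm 'I_n}).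
Hypothesis gh : forall u v, g u v = h (sigma u) (sigma v).

Lemma isomorphic_deg v : deg g v = deg h (sigma v).
Proof.
rewrite !deg_sum [RHS](reindex_inj (@perm_inj _ sigma)).
by apply: eq_bigr => u _; rewrite gh.
Qed.

Lemma isomorphic_perron (l : R) f : perron h l f -> perron g l (fun v => f (sigma v)).
Proof.
move=> [f_gt0 fE]; split=> // v; rewrite -fE /signless isomorphic_deg; congr (_ + _)%R.
rewrite /nbsum [RHS](reindex_inj (@perm_inj _ sigma)).
by apply: eq_bigr => u _; rewrite gh.
Qed.
End Isomorphism.

Section BFDUnique.

Section ParentSeq.
Variables (n : nat) (g : rel 'I_n) (x : 'I_n) (s : seq 'I_n).
Hypotheses (gT : is_tree g) (bfd : BFD_ordering g x s).

Let n_gt0 : (0 < n)%N. Proof. by case: gT. Qed.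
Let gS : symmetric g. Proof. by case: gT => _ [[]]. Qed.
Let gI : irreflexive g. Proof. by case: gT => _ [[]]. Qed.
Let gC : connected g. Proof. by case: gT => _ [_ []]. Qed.
Let gA : acyclic g. Proof. by case: gT => _ [_ []]. Qed.
Let gx : rooted_forest g x := tree_rooted gC gS gI x gA.

Lemma BFD_perm : perm_eq s (enum 'I_n). Proof. by case: bfd. Qed.

Lemma BFD_size : size s = n.
Proof. by rewrite (perm_size BFD_perm) size_enum_ord. Qed.

Lemma BFD_uniq : uniq s.
Proof. by rewrite (perm_uniq BFD_perm) enum_uniq. Qed.

Lemma BFD_mem v : v \in s.
Proof. by rewrite (perm_mem BFD_perm) mem_enum. Qed.

Lemma BFD_cons : s = x :: behead s.
Proof.
have hs : head x s = x by case: bfd.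
have : 0 < size s by rewrite BFD_size.
by case: (s) hs => //= y r ->.
Qed.

Lemma BFD_index_gt0 v : (0 < index v s) = (v != x).
Proof. by rewrite BFD_cons /= eq_sym; case: eqP. Qed.

Lemma BFD_sorted_deg : sorted geq [seq deg g v | v <- s].
Proof.
case: bfd => _ _ _ _ degs; apply/(sortedP 0) => i; rewrite size_map => ltis.
rewrite !(nth_map x) //; last exact: ltnW.
by apply: degs; rewrite /prec !index_uniq ?BFD_uniq // ltnW.
Qed.

(** A code for the tree relative to the ordering; [behead] drops the root. *)
Definition parent_seq := [seq index (parent g x v) s | v <- behead s].

(** By (B1), a descent between parents would reverse the order of their children. *)
Lemma parent_seq_sorted : sorted leq parent_seq.
Proof.
case: bfd => _ _ _ par _; apply/(sortedP 0) => i; rewrite size_map => ltis.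
rewrite !(nth_map x) //; last exact: ltnW.
have := BFD_uniq; rewrite {1}BFD_cons /= => /andP[xs us].
have neq j : j < size (behead s) -> nth x (behead s) j != x.
  by move=> js; apply: contraNneq xs => <-; apply: mem_nth.
set u := nth x _ i; set v := nth x _ i.+1.
have uv : prec s u v.
  rewrite /prec BFD_cons /= ![x == _]eq_sym (negbTE (neq _ ltis)) (negbTE (neq _ (ltnW ltis))).
  by rewrite ltnS !index_uniq // ltnW.
rewrite leqNgt; apply/negP => lt.
have := par _ _ _ _ (child_parent gT (neq _ ltis)) (child_parent gT (neq _ (ltnW ltis))) lt.
by rewrite /prec ltnNge ltnW.
Qed.

Lemma childP w v : child g x w v = (v != x) && (parent g x v == w).
Proof.
apply/idP/andP => [wv|[vx /eqP<-]]; last exact: child_parent.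
by rewrite (parentE gT wv) eqxx (child_neq_root gC wv).
Qed.

(** The neighbours of [w] are its children and, away from the root, exactly one parent. *)
Lemma count_parent_seq w :
  count_mem (index w s) parent_seq + (w != x) = deg g w.
Proof.
have -> : count_mem (index w s) parent_seq = \sum_v child g x w v.
  rewrite count_map -big_enum /= -(perm_big _ BFD_perm) /= -sum1_count big_mkcond /=.
  have -> : \sum_(v <- s) child g x w v = \sum_(v <- behead s) child g x w v.
    by rewrite {1}BFD_cons big_cons [child g x w x]childP eqxx.
  have := BFD_uniq; rewrite {1}BFD_cons /= => /andP[xs us].
  rewrite [LHS]big_seq [RHS]big_seq; apply: eq_bigr => v vs.
  have vx : v != x by apply: contraNneq xs => <-.
  rewrite childP vx /=.
  suff -> : (index (parent g x v) s == index w s) = (parent g x v == w) by case: eqP.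
  by apply/eqP/eqP => [/(index_inj x (BFD_mem _) (BFD_mem _))|->].
rewrite -(rooted_parents gC _ gx) -big_split deg_sum; apply: eq_bigr => u _ /=.
have [guw|ng] := boolP (g w u); last first.
  by rewrite /child (negbTE ng) gS (negbTE ng).
have := gx.1 _ _ guw; rewrite /child gS [g u w]gS guw /=.
by case: eqP => [->|]; case: eqP => // /eqP; rewrite ltn_eqF.
Qed.

(** The code determines the tree. The predecessor accounts for the root, absent from the
    sequence. *)
Lemma child_parent_seq w v : child g x w v =
  (0 < index v s) && (nth 0 parent_seq (index v s).-1 == index w s).
Proof.
rewrite childP BFD_index_gt0; case: (eqVneq v x) => //= vx.
have vs := BFD_mem v.
have iv : index v s = (index v (behead s)).+1.
  by rewrite {1}BFD_cons /= eq_sym (negbTE vx).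
have vb : v \in behead s by move: vs; rewrite {1}BFD_cons inE (negbTE vx).
rewrite iv /= (nth_map x) ?index_mem // nth_index //.
by apply/eqP/eqP => [->//|/(index_inj x (BFD_mem _) (BFD_mem _))].
Qed.
End ParentSeq.

Variables (n : nat) (g h : rel 'I_n) (x y : 'I_n) (s t : seq 'I_n).
Hypotheses (gT : is_tree g) (hT : is_tree h).
Hypotheses (gb : BFD_ordering g x s) (hb : BFD_ordering h y t).
Hypothesis gh : perm_eq (degrees g) (degrees h).

Lemma BFD_deg_eq : [seq deg g v | v <- s] = [seq deg h v | v <- t].
Proof.
apply: (@sorted_eq _ geq).
- by move=> a b c ba cb; apply: leq_trans cb ba.
- by move=> a b; rewrite -eqn_leq => /eqP.
- exact: BFD_sorted_deg gb.
- exact: BFD_sorted_deg hb.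
rewrite (perm_trans (perm_map _ (BFD_perm gb))) //.
by rewrite (perm_trans gh) // perm_sym perm_map // (BFD_perm hb).
Qed.

(** Sorted sequences with equal multiplicities agree, and the multiplicity of position [i] is fixed
    by the degree there, which by (B2) is the same in both trees. *)
Lemma BFD_parent_seq_eq : parent_seq g x s = parent_seq h y t.
Proof.
have st : size s = size t by rewrite (BFD_size gb) (BFD_size hb).
apply: (sorted_eq leq_trans anti_leq); rewrite ?parent_seq_sorted //.
apply/allP => i i_in; apply/eqP.
have lt_i : i < n.
  move: i_in; rewrite mem_cat => /orP[] /mapP[v _ ->].
    by rewrite -[X in _ < X](BFD_size gb) index_mem (BFD_mem gb).
  by rewrite -[X in _ < X](BFD_size hb) index_mem (BFD_mem hb).
have is_ : i < size s by rewrite (BFD_size gb).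
have it : i < size t by rewrite (BFD_size hb).
have := count_parent_seq gT gb (nth x s i); have := count_parent_seq hT hb (nth y t i).
rewrite -(BFD_index_gt0 gT gb) -(BFD_index_gt0 hT hb) !index_uniq ?(BFD_uniq gb) ?(BFD_uniq hb) //.
move=> ch cg; apply: (@addIn (0 < i)); rewrite ch cg.
by rewrite -(nth_map x 0) // BFD_deg_eq (nth_map y).
Qed.

Lemma BFD_isomorphic : isomorphic g h.
Proof.
have st : size s = size t by rewrite (BFD_size gb) (BFD_size hb).
pose sg v := nth y t (index v s).
have isg v : index (sg v) t = index v s.
  by rewrite index_uniq ?(BFD_uniq hb) // -st index_mem (BFD_mem gb).
have sgI : injective sg.
  move=> u v /(congr1 (index^~ t)); rewrite !isg.
  exact: (index_inj x (BFD_mem gb _) (BFD_mem gb _)).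
exists (perm sgI) => u v; rewrite !permE.
have chE a b : child g x a b = child h y (sg a) (sg b).
  rewrite (child_parent_seq gT gb) (child_parent_seq hT hb) !isg.
  by rewrite BFD_parent_seq_eq.
have edgeE (k : rel 'I_n) z a b : is_tree k -> k a b = child k z a b || child k z b a.
  move=> kT; have [_ kS kI kC _] := (is_treeP k).1 kT.
  apply/idP/orP => [/(tree_rooted kC kS kI z kT.2.2.2).1/orP//|].
  by case=> /andP[]; rewrite // kS.
by rewrite (edgeE g x) // (edgeE h y) // !chE.
Qed.
End BFDUnique.

(** * Existence of extremal trees *)

Section PerronMaximal.
Local Open Scope ring_scope.

Lemma eq_deg n (g h : rel 'I_n) : g =2 h -> deg g =1 deg h.
Proof. by move=> gh v; apply: eq_card => u; rewrite !inE gh. Qed.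

Lemma eq_is_tree n (g h : rel 'I_n) : g =2 h -> is_tree g -> is_tree h.
Proof.
move=> gh /is_treeP[n_gt0 gS gI gC gd]; apply/is_treeP; split=> //.
- by move=> x y; rewrite -!gh gS.
- by move=> x; rewrite -gh gI.
- by move=> x y; rewrite -(eq_connect gh).
- by rewrite -gd; apply: eq_bigr => v _; rewrite (eq_deg gh).
Qed.

(** A boolean test makes the trees a finite set over which Perron roots can be maximised. *)
Lemma is_tree_dec n (g : rel 'I_n) : exists b : bool, is_tree g <-> b.
Proof.
exists [&& (0 < n)%N, [forall x, forall y, g x y == g y x], [forall x, ~~ g x x],
  [forall x, forall y, connect g x y] & (\sum_v deg g v == (n.-1).*2)%N].
split=> [/is_treeP[-> gS gI gC /eqP->]|].
  rewrite andbT /=; apply/and3P; split; apply/forallP => x; rewrite ?gI //;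
    by apply/forallP => y; rewrite // gS.
case/and5P => n_gt0 /forallP gS /forallP gI /forallP gC /eqP gd.
apply/is_treeP; split=> //; first by move=> x y; move/forallP/(_ y)/eqP: (gS x).
  by move=> x; apply/negbTE/gI.
by move=> x y; move/forallP/(_ y): (gC x).
Qed.

Lemma perron_maximal_exists (R : rcfType) n (g : rel 'I_n) : is_tree g ->
  exists (h : rel 'I_n) (l : R) f,
    [/\ is_tree h, perm_eq (degrees h) (degrees g), perron h l f
      & perron_maximal h l].
Proof.
move=> gT; pose T := {ffun 'I_n * 'I_n -> bool}.
pose rel_of (t : T) : rel 'I_n := fun x y => t (x, y).
pose ffun_of (h : rel 'I_n) : T := [ffun p => h p.1 p.2].
have ffunK h : h =2 rel_of (ffun_of h) by move=> x y; rewrite /rel_of ffunE.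
have [tb tbP] := fin_all_exists (fun t => is_tree_dec (rel_of t)).
have [L LP] : exists L : T -> R,
    forall t, tb t -> exists f, perron (rel_of t) (L t) f.
  apply: (@fin_all_exists T (fun=> R)
            (fun t l => tb t -> exists f, perron (rel_of t) l f)) => t.
  (* Relations that are not trees get the dummy value 0; the maximum ranges over trees only. *)
  have [tt|_] := boolP (tb t); last by exists 0.
  have /is_treeP[n_gt0 tS tI tC _] := (tbP t).2 tt.
  by have [l [f tf]] := perron_exists R n_gt0 (conj tS tI) tC; exists l => _; exists f.
pose P t := tb t && perm_eq (degrees (rel_of t)) (degrees g).
have PP h : is_tree h -> perm_eq (degrees h) (degrees g) -> P (ffun_of h).
  move=> hT hg; apply/andP; split; first by apply/tbP/(eq_is_tree (ffunK h)).
  by rewrite /degrees -(eq_map (eq_deg (ffunK h))).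
have [t /andP[tt tg] tmax] : exists2 t, P t & forall t', P t' -> L t' <= L t.
  exists [arg max_(t > ffun_of g | P t) L t]%O;
    by case: arg_maxP; rewrite ?PP // => i Pi imax t' Pt'; apply: imax.
have [f tf] := LP _ tt; exists (rel_of t), (L t), f; split=> //; first exact/tbP.
move=> h l' f' hT ht hf'; have hg := perm_trans ht tg.
have Ph := PP h hT hg; apply: le_trans (tmax _ Ph).
have [f'' hf''] := LP _ (andP Ph).1.
(* [h] and its encoding agree pointwise, so the Perron pair is transported along the identity
   permutation. *)
have hf : perron h (L (ffun_of h)) (fun v => f'' ((1 : {perm _})%g v)).
  by apply: isomorphic_perron hf'' => u v; rewrite !perm1 ffunK.
by rewrite (largest_eig_perron hT (perron_largest_eig hT hf') hf).
Qed.

End PerronMaximal.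

(** * Characterisation, uniqueness and consistent orderings *)

Local Open Scope ring_scope.

Theorem theorem1 (R : rcfType) (pi : seq nat) (g : rel 'I_(size pi)) :
  tree_seq pi -> in_Tpi pi g ->
  [/\ (extremal R pi g <-> BFD_tree g),
      (forall h : rel 'I_(size pi), in_Tpi pi h ->
         extremal R pi g -> extremal R pi h -> isomorphic g h) &
      (extremal R pi g ->
         forall (l : R) (f : 'rV[R]_(size pi)),
           largest_eig (laplacian R g) l -> eigenvector (laplacian R g) l f ->
           exists (v0 : 'I_(size pi)) (s : seq 'I_(size pi)),
             BFD_ordering g v0 s /\
             (forall u v, `|f ord0 v| < `|f ord0 u| -> prec s u v))].
Proof.
move=> _ gpi.
have ex_perron (h : rel 'I_(size pi)) : is_tree h -> exists l f, perron (R := R) h l f.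
  by move=> /is_treeP[n_gt0 hS hI hC _]; apply: perron_exists.
(* A single Perron pair suffices to test extremality, because the largest eigenvalue is unique. *)
have maxE (h : rel 'I_(size pi)) (l : R) f : in_Tpi pi h -> perron h l f ->
    extremal R pi h <-> perron_maximal h l.
  move=> [hT hpi] hf; split=> [[l0 [ll0 lmax]] h' l' f' h'T h'h h'f'|hmax].
    rewrite -(largest_eig_perron hT ll0 hf); apply: (lmax h').
      by split=> //; apply: perm_trans h'h hpi.
    exact: perron_largest_eig h'f'.
  exists l; split; first exact: perron_largest_eig hf.
  move=> t l' [tT tpi] ll'; have [l'' [f'' tf'']] := ex_perron t tT.
  rewrite (largest_eig_perron tT ll' tf''); apply: hmax tT _ tf''.
  by apply: perm_trans tpi _; rewrite perm_sym.
have ordering (h : rel 'I_(size pi)) (l : R) f : in_Tpi pi h -> perron h l f ->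
    extremal R pi h -> exists v0 s, BFD_ordering h v0 s /\
      (forall u v, f v < f u -> prec s u v).
  move=> hpi hf /(maxE _ _ _ hpi hf) hmax.
  exact: extremal_BFD_ordering hpi.1 hf hmax.
have ext_BFD h : in_Tpi pi h -> extremal R pi h -> BFD_tree h.
  move=> hpi hext; split; first by case: hpi.
  have [l [f hf]] := ex_perron h hpi.1.
  by have [v0 [s [hb _]]] := ordering h l f hpi hf hext; exists v0, s.
have BFD_iso (h h' : rel 'I_(size pi)) : in_Tpi pi h -> in_Tpi pi h' ->
    BFD_tree h -> BFD_tree h' -> isomorphic h h'.
  move=> [_ hpi] [_ h'pi] [hT [v [s hb]]] [h'T [v' [s' h'b]]].
  apply: (BFD_isomorphic hT h'T hb h'b).
  by apply: perm_trans hpi _; rewrite perm_sym.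
split.
- split=> [|gB]; first exact: ext_BFD.
  (* Some maximal tree [h] exists and is a BFD-tree, so [g] is isomorphic to it; its Perron pair
     pulls back to [g], and maximality with it. *)
  have [h [l [f [hT hg hf hmax]]]] := perron_maximal_exists R gpi.1.
  have hpi : in_Tpi pi h by split=> //; apply: perm_trans hg gpi.2.
  have hext : extremal R pi h by apply/(maxE _ _ _ hpi hf).
  have [sigma gh] := BFD_iso g h gpi hpi gB (ext_BFD h hpi hext).
  apply/(maxE _ _ _ gpi (isomorphic_perron gh hf)) => t l' f' tT tg.
  by apply: hmax tT _; apply: perm_trans tg _; rewrite perm_sym.
- by move=> h hpi gext hext; apply: BFD_iso; rewrite //; apply: ext_BFD.
- move=> gext l f ll lf.
  exact: ordering gpi (eigenvector_perron gpi.1 ll lf) gext.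
Qed.
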